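(* There is a natural $n$-dimensional differential calculus on $U(\mathfrak b_{n+})$ induced (in the sense explained in the context) from the natural 2-dimensional calculus on $U(\mathfrak b_+)$ described in the context. It obeys the relations $$[a,\mathrm dx_0]=0\quad\forall a\in U(\mathfrak b_{n+}),\qquad [x_i,\mathrm dx_j]=0,\quad [x_0,\mathrm dx_i]=\mathrm dx_i\qquad\forall i,j\ge1,$$ $$\mathrm d{:}f{:}=\sum_{\mu=0}^{n-1}\mathrm dx_\mu\,{:}\frac{\partial}{\partial x_\mu}f{:}$$ for $f\in\Bbbk[x_0,\dots,x_{n-1}]$, where the normal ordering ${:}\cdot{:}$ is given by $$\Bbbk[x_0,\dots,x_{n-1}]\to U(\mathfrak b_{n+})\quad\text{via}\quad x_{n-1}^{m_{n-1}}\cdots x_0^{m_0}\mapsto x_{n-1}^{m_{n-1}}\cdots x_0^{m_0}.$$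
   Context: $\Bbbk$ is a field of characteristic $0$. $\mathfrak b_{n+}$ is the Lie algebra over $\Bbbk$ generated by $x_0,\dots,x_{n-1}$ with relations $[x_0,x_i]=x_i$, $[x_i,x_j]=0$ for all $i,j\ge1$; $U(\mathfrak b_{n+})$ is its enveloping algebra, a Hopf algebra with primitive generators ((rescaled) $\kappa$-Minkowski space), regarded as a quantum function algebra. $\mathfrak b_+$ is the Lie algebra with generators $X,H$ and $[H,X]=X$, and $U(\mathfrak b_+)$ is its enveloping algebra, regarded in the same way. ''Differential calculus'' on a Hopf algebra $A$ means bicovariant first order differential calculus. By Woronowicz these are in bijection with subspaces $M\subseteq\ker\epsilon\subset A$ with $AM\subseteq M$ and $\mathrm{Ad_L}(M)\subseteq A\otimes M$, $\mathrm{Ad_L}(v)=v_{(1)}S v_{(3)}\otimes v_{(2)}$ (the second condition is automatic for cocommutative $A$). The calculus given by $M$ is $\Gamma=(\ker\epsilon/M)\otimes A$ with right action $(v\otimes b)c=v\otimes bc$, left action $a(v\otimes b)=a_{(1)}v\otimes a_{(2)}b$ and $\mathrm da=\pi(\Delta a-1\otimes a)$, $\pi$ the canonical projection on the first factor. Its dimension is $\dim(\ker\epsilon/M)$. $[a,\eta]=a\eta-\eta a$. The calculus on $U(\mathfrak b_+)$ from which one starts is the unique 2-dimensional differential calculus on $U(\mathfrak b_+)$ with $\mathrm dX\ne0$, $\mathrm dH\ne0$, $\mathrm dP(H)=\mathrm dH\,\frac{\partial}{\partial H}P(H)$ and $\mathrm dP(X)=\mathrm dX\,\frac{\partial}{\partial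 X}P(X)$ for all polynomials $P$. ''Induced'': the Lie algebra homomorphism $\mathfrak b_{n+}\to\mathfrak b_+$, $x_0\mapsto H$, $x_i\mapsto X$ ($i\ge1$), extends to enveloping algebras. Taking the pre-image of submodules gives a map from the submodules of $U(\mathfrak b_+)$ to those of $U(\mathfrak b_{n+})$, and thereby a map from the differential calculi on $U(\mathfrak b_+)$ to the differential calculi on $U(\mathfrak b_{n+})$ that are invariant under permutations of the $x_i$, $i\ge1$.
   Formalization: The pre-image under the single map x_i↦X is only 2-dimensional for n≥3; the n-dimensional calculus is instead the intersection of pre-images under all Lie maps x_0↦H, x_i↦c_iX. The relations are proved for both, and the two agree for n≤2. *)

(* Defs.v *)
From HB Require Import structures.
From mathcomp Require Import mpoly.
From mathcomp Require Import all_boot perm all_algebra ring.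
From mathcomp Require Import boolp.

Set Implicit Arguments.
Unset Strict Implicit.
Unset Printing Implicit Defensive.

Import GRing.Theory.
Local Open Scope ring_scope.
Local Open Scope quotient_scope.

(* Vector spaces are [lmodType]s over a field, in general of infinite          *)
(* dimension. Subspaces (such as the submodules classifying calculi) are       *)
(* Prop-valued predicates.                                                     *)

Section Subspaces.
Variables (k : fieldType) (V : lmodType k).

Definition subspace (N : V -> Prop) : Prop :=
  N 0 /\ (forall (a : k) u v, N u -> N v -> N (a *: u + v)).

Definition lspan (M : V -> Prop) (u : V) : Prop :=
  forall N, subspace N -> (forall v, M v -> N v) -> N u.

Definition has_dim (n : nat) : Prop :=
  exists f : {linear 'rV[k]_n -> V}, bijective f.

Lemma lspan_subspace M : subspace (lspan M).
Proof.
split=> [N [N0 _] _ //|a u v uM vM N Ns MN].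
by case: (Ns) => _; apply; [apply: uM | apply: vM].
Qed.

Lemma lspan_incl (M : V -> Prop) u : M u -> lspan M u.
Proof. by move=> Mu N _; apply. Qed.

Lemma lspan_id (M : V -> Prop) : subspace M -> forall u, lspan M u <-> M u.
Proof. by move=> sM u; split=> [|/lspan_incl//]; apply. Qed.

Lemma lspan0 M : lspan M 0. Proof. by case: (lspan_subspace M). Qed.

Lemma lspanP M a u v : lspan M u -> lspan M v -> lspan M (a *: u + v).
Proof. by case: (lspan_subspace M) => _; apply. Qed.

Lemma lspanD M u v : lspan M u -> lspan M v -> lspan M (u + v).
Proof. by move=> uM vM; have := lspanP 1 uM vM; rewrite scale1r. Qed.

Lemma lspanZ M a u : lspan M u -> lspan M (a *: u).
Proof. by move=> uM; have := lspanP a uM (@lspan0 M); rewrite addr0. Qed.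

Lemma lspanN M u : lspan M u -> lspan M (- u).
Proof. by rewrite -scaleN1r; apply: lspanZ. Qed.

End Subspaces.

Arguments has_dim {k} V n.

(* The quotient of V by the subspace spanned by M.                             *)
Section Quotient.
Variables (k : fieldType) (V : lmodType k) (M : V -> Prop).

Definition quot_rel (u v : V) : bool := `[< lspan M (u - v) >].

Lemma quot_rel_refl : reflexive quot_rel.
Proof. by move=> u; apply/asboolP; rewrite subrr; apply: lspan0. Qed.

Lemma quot_rel_sym : symmetric quot_rel.
Proof.
move=> u v; apply/asbool_equiv_eq.
by split=> /lspanN; rewrite opprB.
Qed.

Lemma quot_rel_trans : transitive quot_rel.
Proof.
move=> v u w /asboolP uv /asboolP vw; apply/asboolP.
by rewrite -(subrK v u) -addrA; apply: lspanD.
Qed.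

Canonical quot_equiv := EquivRel quot_rel quot_rel_refl quot_rel_sym quot_rel_trans.

Definition quot := {eq_quot quot_equiv}.
HB.instance Definition _ := Choice.on quot.
HB.instance Definition _ := EqQuotient.on quot.

Definition qproj (u : V) : quot := \pi u.

Lemma qprojP u v : qproj u = qproj v <-> lspan M (u - v).
Proof.
split=> [uv|uv]; first exact/asboolP/(@eqquotP _ quot_equiv quot u v).
by apply/(@eqquotP _ quot_equiv quot u v)/asboolP.
Qed.

Lemma qrepr q : qproj (repr q) = q. Proof. exact: reprK. Qed.

Lemma quot_ind (P : quot -> Prop) : (forall u, P (qproj u)) -> forall q, P q.
Proof. by move=> Pq q; rewrite -[q]qrepr. Qed.

Definition qadd (p q : quot) := qproj (repr p + repr q).
Definition qopp (q : quot) := qproj (- repr q).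
Definition qscale (a : k) (q : quot) := qproj (a *: repr q).

Lemma qreprP u : lspan M (repr (qproj u) - u).
Proof. by apply/qprojP; rewrite qrepr. Qed.

Lemma qaddE u v : qadd (qproj u) (qproj v) = qproj (u + v).
Proof. by apply/qprojP; rewrite opprD addrACA; apply: lspanD; apply: qreprP. Qed.

Lemma qoppE u : qopp (qproj u) = qproj (- u).
Proof. by apply/qprojP; rewrite -opprD; apply: lspanN (qreprP u). Qed.

Lemma qscaleE a u : qscale a (qproj u) = qproj (a *: u).
Proof. by apply/qprojP; rewrite -scalerBr; apply: lspanZ (qreprP u). Qed.

Lemma qaddA : associative qadd.
Proof. by elim/quot_ind=> u; elim/quot_ind=> v; elim/quot_ind=> w; rewrite !qaddE addrA. Qed.
Lemma qaddC : commutative qadd.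
Proof. by elim/quot_ind=> u; elim/quot_ind=> v; rewrite !qaddE addrC. Qed.
Lemma qadd0 : left_id (qproj 0) qadd.
Proof. by elim/quot_ind=> u; rewrite !qaddE add0r. Qed.
Lemma qaddN : left_inverse (qproj 0) qopp qadd.
Proof. by elim/quot_ind=> u; rewrite qoppE !qaddE addNr. Qed.
HB.instance Definition _ := GRing.isZmodule.Build quot qaddA qaddC qadd0 qaddN.

Lemma qprojD u v : qproj (u + v) = qproj u + qproj v.
Proof. by rewrite -qaddE. Qed.

Lemma qscaleA a b q : qscale a (qscale b q) = qscale (a * b) q.
Proof. by elim/quot_ind: q => u; rewrite !qscaleE scalerA. Qed.
Lemma qscale1 : left_id 1 qscale.
Proof. by elim/quot_ind=> u; rewrite !qscaleE scale1r. Qed.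
Lemma qscaleDr : right_distributive qscale +%R.
Proof.
by move=> a; elim/quot_ind=> u; elim/quot_ind=> v; rewrite -qprojD !qscaleE scalerDr qprojD.
Qed.
Lemma qscaleDl q : {morph qscale^~ q : a b / a + b}.
Proof. by move=> a b; elim/quot_ind: q => u; rewrite !qscaleE scalerDl qprojD. Qed.
HB.instance Definition _ :=
  GRing.Zmodule_isLmodule.Build k quot qscaleA qscale1 qscaleDr qscaleDl.

Lemma qproj_is_linear : linear qproj.
Proof. by move=> a u v; rewrite qprojD -qscaleE. Qed.
HB.instance Definition _ := GRing.isLinear.Build k V quot _ qproj qproj_is_linear.

End Quotient.

(* The tensor product over k: formal sums of pairs, two of them being          *)
(* identified when no bilinear map separates them.                             *)
Section Tensor.
Variables (k : fieldType) (V W : lmodType k).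

Definition bilin (Z : lmodType k) (f : V -> W -> Z) : Prop :=
  (forall w, linear (fun v => f v w)) /\ (forall v, linear (f v)).

Definition teval (Z : lmodType k) (f : V -> W -> Z) (s : seq (V * W)) : Z :=
  \sum_(p <- s) f p.1 p.2.

Definition tens_rel (s t : seq (V * W)) : bool :=
  `[< forall (Z : lmodType k) (f : V -> W -> Z), bilin f -> teval f s = teval f t >].

Lemma tens_rel_refl : reflexive tens_rel.
Proof. by move=> s; apply/asboolP. Qed.
Lemma tens_rel_sym : symmetric tens_rel.
Proof. by move=> s t; apply/asbool_equiv_eq; split=> st Z f /st. Qed.
Lemma tens_rel_trans : transitive tens_rel.
Proof.
move=> t s r /asboolP st /asboolP tr; apply/asboolP => Z f bf.
by rewrite st // tr.
Qed.

Canonical tens_equiv := EquivRel tens_rel tens_rel_refl tens_rel_sym tens_rel_trans.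

Definition tens := {eq_quot tens_equiv}.
HB.instance Definition _ := Choice.on tens.
HB.instance Definition _ := EqQuotient.on tens.

Definition tpi (s : seq (V * W)) : tens := \pi s.

Definition tpure (v : V) (w : W) : tens := tpi [:: (v, w)].

(* The linear map induced by a bilinear map f; it is only used for such f.     *)
Definition tlift (Z : lmodType k) (f : V -> W -> Z) (t : tens) : Z :=
  teval f (repr t).

Lemma tpiP s t : tpi s = tpi t <->
  (forall (Z : lmodType k) (f : V -> W -> Z), bilin f -> teval f s = teval f t).
Proof.
split=> [st|st]; first exact/asboolP/(@eqquotP _ tens_equiv tens s t).
by apply/(@eqquotP _ tens_equiv tens s t)/asboolP.
Qed.

Lemma tlift_pi (Z : lmodType k) (f : V -> W -> Z) s :
  bilin f -> tlift f (tpi s) = teval f s.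
Proof. by move: Z f; apply/tpiP; apply: reprK. Qed.
Lemma teval_cat (Z : lmodType k) (f : V -> W -> Z) s t :
  teval f (s ++ t) = teval f s + teval f t.
Proof. exact: big_cat. Qed.

Lemma bilinZl (Z : lmodType k) (f : V -> W -> Z) a v w :
  bilin f -> f (a *: v) w = a *: f v w.
Proof.
case=> fl _; have f0 : f 0 w = 0.
  by have := fl w (-1) 0 0; rewrite scaler0 addr0 scaleN1r addNr.
by rewrite -[a *: v]addr0 fl f0 addr0.
Qed.

Lemma teval_scale (Z : lmodType k) (f : V -> W -> Z) a s : bilin f ->
  teval f [seq (a *: p.1, p.2) | p <- s] = a *: teval f s.
Proof.
move=> bf; rewrite /teval big_map scaler_sumr; apply: eq_bigr => p _ /=.
exact: bilinZl.
Qed.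

Lemma tens_rep (P : tens -> Prop) : (forall s, P (tpi s)) -> forall t, P t.
Proof. by move=> Pt t; have := Pt (repr t); rewrite /tpi reprK. Qed.

Lemma tens_eq (s t : tens) :
  (forall (Z : lmodType k) (f : V -> W -> Z), bilin f -> tlift f s = tlift f t) ->
  s = t.
Proof.
elim/tens_rep: s => s; elim/tens_rep: t => t st; apply/tpiP => Z f bf.
by rewrite -!tlift_pi //; apply: st.
Qed.

Definition tadd (s t : tens) := tpi (repr s ++ repr t).
Definition tscale (a : k) (s : tens) := tpi [seq (a *: p.1, p.2) | p <- repr s].

Lemma tlift_add (Z : lmodType k) (f : V -> W -> Z) s t : bilin f ->
  tlift f (tadd s t) = tlift f s + tlift f t.
Proof. by move=> bf; rewrite tlift_pi // teval_cat. Qed.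

Lemma tlift_tscale (Z : lmodType k) (f : V -> W -> Z) a s : bilin f ->
  tlift f (tscale a s) = a *: tlift f s.
Proof. by move=> bf; rewrite tlift_pi // teval_scale. Qed.

Lemma tlift_nil (Z : lmodType k) (f : V -> W -> Z) : bilin f ->
  tlift f (tpi [::]) = 0.
Proof. by move=> bf; rewrite tlift_pi // /teval big_nil. Qed.

Let tE := (tlift_add, tlift_tscale, tlift_nil).

Lemma taddA : associative tadd.
Proof. by move=> r s t; apply: tens_eq => Z f bf; rewrite !tE // addrA. Qed.
Lemma taddC : commutative tadd.
Proof. by move=> r s; apply: tens_eq => Z f bf; rewrite !tE // addrC. Qed.
Lemma tadd0 : left_id (tpi [::]) tadd.
Proof. by move=> r; apply: tens_eq => Z f bf; rewrite !tE // add0r. Qed.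
Lemma taddN : left_inverse (tpi [::]) (tscale (-1)) tadd.
Proof.
by move=> r; apply: tens_eq => Z f bf; rewrite !tE // scaleN1r addNr.
Qed.
HB.instance Definition _ := GRing.isZmodule.Build tens taddA taddC tadd0 taddN.

Lemma tliftD (Z : lmodType k) (f : V -> W -> Z) s t : bilin f ->
  tlift f (s + t) = tlift f s + tlift f t.
Proof. exact: tlift_add. Qed.

Let tE' := (tliftD, tlift_tscale).

Lemma tscaleA a b s : tscale a (tscale b s) = tscale (a * b) s.
Proof. by apply: tens_eq => Z f bf; rewrite !tE' // scalerA. Qed.
Lemma tscale1 : left_id 1 tscale.
Proof. by move=> s; apply: tens_eq => Z f bf; rewrite !tE' // scale1r. Qed.
Lemma tscaleDr : right_distributive tscale +%R.
Proof. by move=> a s t; apply: tens_eq => Z f bf; rewrite !tE' // scalerDr. Qed.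
Lemma tscaleDl s : {morph tscale^~ s : a b / a + b}.
Proof. by move=> a b; apply: tens_eq => Z f bf; rewrite !tE' // scalerDl. Qed.
HB.instance Definition _ :=
  GRing.Zmodule_isLmodule.Build k tens tscaleA tscale1 tscaleDr tscaleDl.

Lemma tliftZ (Z : lmodType k) (f : V -> W -> Z) a s : bilin f ->
  tlift f (a *: s) = a *: tlift f s.
Proof. exact: tlift_tscale. Qed.

Lemma tlift_linear (Z : lmodType k) (f : V -> W -> Z) :
  bilin f -> linear (tlift f).
Proof. by move=> bf a s t; rewrite tliftD // tliftZ. Qed.

Lemma tlift_pure (Z : lmodType k) (f : V -> W -> Z) v w :
  bilin f -> tlift f (tpure v w) = f v w.
Proof. by move=> bf; rewrite tlift_pi // /teval big_seq1. Qed.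

Lemma tpure_bilin : bilin tpure.
Proof.
split=> [w a u v|v a u w]; apply: tens_eq => Z f bf;
  by rewrite tliftD // tliftZ // !tlift_pure //; case: bf => fl fr; rewrite (fl, fr).
Qed.

Lemma tpi_sum s : tpi s = \sum_(p <- s) tpure p.1 p.2.
Proof.
elim: s => [|[v w] s IHs]; first by rewrite big_nil.
rewrite big_cons -IHs; apply: tens_eq => Z f bf.
by rewrite tliftD // tlift_pure // !tlift_pi // /teval big_cons.
Qed.

Lemma tens_ind (P : tens -> Prop) :
  P 0 -> (forall v w s, P s -> P (tpure v w + s)) -> forall s, P s.
Proof.
move=> P0 PS; elim/tens_rep=> s; rewrite tpi_sum.
by elim: s => [|p s IHs]; rewrite ?big_nil // big_cons; apply: PS.
Qed.

Lemma tlift_ext (Z : lmodType k) (f g : V -> W -> Z) :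
  (forall v w, f v w = g v w) -> forall t, tlift f t = tlift g t.
Proof. by move=> fg t; apply: eq_bigr => p _; apply: fg. Qed.

Lemma tlift_fun_linear (U Z : lmodType k) (f : U -> V -> W -> Z) t :
  (forall v w, linear (fun u => f u v w)) -> linear (fun u => tlift (f u) t).
Proof.
move=> fl a u v; rewrite /tlift /teval scaler_sumr -big_split.
by apply: eq_bigr => p _; apply: fl.
Qed.

End Tensor.

Notation "v \ox w" := (tpure v w) (at level 40, no associativity) : ring_scope.

(* The product algebra: (a \ox b) (c \ox d) = (a c) \ox (b d).                 *)
Section TensorAlgebra.
Variables (k : fieldType) (A B : algType k).

Definition tmul (s t : tens A B) : tens A B :=
  tlift (fun a b => tlift (fun c d => (a * c) \ox (b * d)) t) s.

Lemma tpurel (V W : lmodType k) (w : W) : linear (fun v : V => v \ox w).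
Proof. by case: (tpure_bilin V W). Qed.
Lemma tpurer (V W : lmodType k) (v : V) : linear (fun w : W => v \ox w).
Proof. by case: (tpure_bilin V W). Qed.

Lemma tmul_in_bilin a b : bilin (fun (c : A) (d : B) => (a * c) \ox (b * d)).
Proof.
by split=> [d x u v|c x u v]; rewrite mulrDr -scalerAr (tpurel, tpurer).
Qed.

Lemma tmul_bilin t :
  bilin (fun a b => tlift (fun c d => (a * c) \ox (b * d)) t : tens A B).
Proof.
split=> [b|a]; apply: tlift_fun_linear => c d x u v;
  by rewrite mulrDl -scalerAl (tpurel, tpurer).
Qed.

Lemma tmul_pure a b c d : tmul (a \ox b) (c \ox d) = (a * c) \ox (b * d).
Proof.
rewrite /tmul tlift_pure; last exact: tmul_bilin.
by rewrite tlift_pure //; apply: tmul_in_bilin.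
Qed.

Lemma tmulDl : left_distributive tmul +%R.
Proof. by move=> s s' t; rewrite /tmul tliftD //; apply: tmul_bilin. Qed.

Lemma tmulZl x s t : tmul (x *: s) t = x *: tmul s t.
Proof. by rewrite /tmul tliftZ //; apply: tmul_bilin. Qed.

Lemma tmul0l t : tmul 0 t = 0.
Proof. by rewrite -[X in tmul X](scale0r (0 : tens A B)) tmulZl scale0r. Qed.

Lemma tmul_linr s : linear (tmul s).
Proof.
move=> x t t'; elim/tens_ind: s => [|a b s IHs].
  by rewrite !tmul0l scaler0 addr0.
rewrite !tmulDl IHs scalerDr addrACA; congr (_ + _).
have tE u : tmul (a \ox b) u = tlift (fun c d => (a * c) \ox (b * d)) u.
  by rewrite /tmul tlift_pure //; apply: tmul_bilin.
by rewrite !tE tlift_linear //; apply: tmul_in_bilin.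
Qed.

Lemma tmulDr : right_distributive tmul +%R.
Proof. by move=> s t t'; have := tmul_linr s 1 t t'; rewrite !scale1r. Qed.

Lemma tmul0r s : tmul s 0 = 0.
Proof. by have := tmul_linr s (-1) 0 0; rewrite scaler0 addr0 scaleN1r addNr. Qed.

Lemma tmulZr x s t : tmul s (x *: t) = x *: tmul s t.
Proof. by rewrite -[x *: t]addr0 tmul_linr tmul0r addr0. Qed.

Lemma tmulA : associative tmul.
Proof.
move=> r s t.
elim/tens_ind: r => [|a b r IHr]; first by rewrite !tmul0l.
rewrite !tmulDl {}IHr; congr (_ + _).
elim/tens_ind: s => [|c d s IHs]; first by rewrite !tmul0l tmul0r tmul0l.
rewrite !(tmulDl, tmulDr) {}IHs; congr (_ + _).
elim/tens_ind: t => [|e f t IHt]; first by rewrite !tmul0r.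
by rewrite !tmulDr {}IHt !tmul_pure !mulrA.
Qed.

Lemma tmul1l : left_id (1 \ox 1) tmul.
Proof.
elim/tens_ind=> [|a b s IHs]; first by rewrite tmul0r.
by rewrite tmulDr IHs tmul_pure !mul1r.
Qed.

Lemma tmul1r : right_id (1 \ox 1) tmul.
Proof.
elim/tens_ind=> [|a b s IHs]; first by rewrite tmul0l.
by rewrite tmulDl IHs tmul_pure !mulr1.
Qed.

HB.instance Definition _ := GRing.Zmodule_isPzRing.Build (tens A B)
  tmulA tmul1l tmul1r tmulDl tmulDr.

Lemma tmulE a b c d : (a \ox b) * (c \ox d) = (a * c) \ox (b * d) :> tens A B.
Proof. exact: tmul_pure. Qed.

End TensorAlgebra.

HB.mixin Record Lmodule_isLie (k : fieldType) V of GRing.Lmodule k V := {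
  lie : V -> V -> V;
  liell : forall v, linear (fun u => lie u v);
  lielr : forall u, linear (lie u);
  liexx : forall u, lie u u = 0;
  jacobi : forall u v w, lie u (lie v w) + lie v (lie w u) + lie w (lie u v) = 0
}.

#[short(type="lieType")]
HB.structure Definition Lie (k : fieldType) := {V of GRing.Lmodule k V & Lmodule_isLie k V}.

Definition lie_morph (k : fieldType) (g h : lieType k) (f : g -> h) : Prop :=
  linear f /\ (forall u v, f (lie u v) = lie (f u) (f v)).

(* Lie algebra homomorphisms to an associative algebra with the commutator.    *)
Definition lie_rep (k : fieldType) (g : lieType k) (B : algType k) (f : g -> B) : Prop :=
  linear f /\ (forall u v, f (lie u v) = f u * f v - f v * f u).

(* The enveloping algebra: linear combinations of words in g (elements of the  *)
(* tensor algebra), two of them being identified when they have the same image *)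
(* under every Lie algebra homomorphism from g to an associative algebra.      *)
Section Enveloping.
Variables (k : fieldType) (g : lieType k).

Definition ueval (B : algType k) (f : g -> B) (s : seq (k * seq g)) : B :=
  \sum_(p <- s) p.1 *: \prod_(v <- p.2) f v.

Definition uenv_rel (s t : seq (k * seq g)) : bool :=
  `[< forall (B : algType k) (f : g -> B), lie_rep f -> ueval f s = ueval f t >].

Lemma uenv_rel_refl : reflexive uenv_rel.
Proof. by move=> s; apply/asboolP. Qed.
Lemma uenv_rel_sym : symmetric uenv_rel.
Proof. by move=> s t; apply/asbool_equiv_eq; split=> st Z f /st. Qed.
Lemma uenv_rel_trans : transitive uenv_rel.
Proof.
move=> t s r /asboolP st /asboolP tr; apply/asboolP => Z f bf.
by rewrite st // tr.
Qed.

Canonical uenv_equiv := EquivRel uenv_rel uenv_rel_refl uenv_rel_sym uenv_rel_trans.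

Definition uenv := {eq_quot uenv_equiv}.
HB.instance Definition _ := Choice.on uenv.
HB.instance Definition _ := EqQuotient.on uenv.

Definition upi (s : seq (k * seq g)) : uenv := \pi s.

Definition uin (v : g) : uenv := upi [:: (1, [:: v])].

(* The algebra map extending f; it is only used when [lie_rep f].              *)
Definition ulift (B : algType k) (f : g -> B) (u : uenv) : B := ueval f (repr u).

Lemma upiP s t : upi s = upi t <->
  (forall (B : algType k) (f : g -> B), lie_rep f -> ueval f s = ueval f t).
Proof.
split=> [st|st]; first exact/asboolP/(@eqquotP _ uenv_equiv uenv s t).
by apply/(@eqquotP _ uenv_equiv uenv s t)/asboolP.
Qed.

Lemma ulift_pi (B : algType k) (f : g -> B) s :
  lie_rep f -> ulift f (upi s) = ueval f s.
Proof. by move: B f; apply/upiP; apply: reprK. Qed.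

Lemma uenv_rep (P : uenv -> Prop) : (forall s, P (upi s)) -> forall u, P u.
Proof. by move=> Pu u; have := Pu (repr u); rewrite /upi reprK. Qed.

Lemma uenv_eq (u v : uenv) :
  (forall (B : algType k) (f : g -> B), lie_rep f -> ulift f u = ulift f v) -> u = v.
Proof.
elim/uenv_rep: u => s; elim/uenv_rep: v => t st; apply/upiP => B f rf.
by rewrite -!ulift_pi //; apply: st.
Qed.

Definition uadd (u v : uenv) := upi (repr u ++ repr v).
Definition uscale (a : k) (u : uenv) := upi [seq (a * p.1, p.2) | p <- repr u].
Definition umul (u v : uenv) :=
  upi [seq (p.1 * q.1, p.2 ++ q.2) | p <- repr u, q <- repr v].
Definition uone := upi [:: (1, [::])].

Section Lift.
Variables (B : algType k) (f : g -> B).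
Hypothesis rf : lie_rep f.

Lemma ulift_uadd u v : ulift f (uadd u v) = ulift f u + ulift f v.
Proof. by rewrite ulift_pi // /ueval big_cat. Qed.

Lemma ulift_uscale a u : ulift f (uscale a u) = a *: ulift f u.
Proof.
rewrite ulift_pi // /ueval big_map scaler_sumr.
by apply: eq_bigr => p _; rewrite scalerA.
Qed.

Lemma ulift_umul u v : ulift f (umul u v) = ulift f u * ulift f v.
Proof.
rewrite ulift_pi // /ulift /ueval big_allpairs_dep mulr_suml.
apply: eq_bigr => p _; rewrite mulr_sumr; apply: eq_bigr => q _ /=.
by rewrite big_cat -scalerAl -scalerAr scalerA.
Qed.

Lemma ulift_uone : ulift f uone = 1.
Proof. by rewrite ulift_pi // /ueval big_seq1 big_nil scale1r. Qed.

Lemma ulift_nil : ulift f (upi [::]) = 0.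
Proof. by rewrite ulift_pi // /ueval big_nil. Qed.

End Lift.

Let uE := (ulift_uadd, ulift_uscale, ulift_umul, ulift_uone, ulift_nil).

Lemma uaddA : associative uadd.
Proof. by move=> r s t; apply: uenv_eq => B f rf; rewrite !uE // addrA. Qed.
Lemma uaddC : commutative uadd.
Proof. by move=> r s; apply: uenv_eq => B f rf; rewrite !uE // addrC. Qed.
Lemma uadd0 : left_id (upi [::]) uadd.
Proof. by move=> r; apply: uenv_eq => B f rf; rewrite !uE // add0r. Qed.
Lemma uaddN : left_inverse (upi [::]) (uscale (-1)) uadd.
Proof. by move=> r; apply: uenv_eq => B f rf; rewrite !uE // scaleN1r addNr. Qed.
HB.instance Definition _ := GRing.isZmodule.Build uenv uaddA uaddC uadd0 uaddN.

Lemma ulift_addE (B : algType k) (f : g -> B) u v : lie_rep f ->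
  ulift f (u + v) = ulift f u + ulift f v.
Proof. by move=> rf; apply: ulift_uadd. Qed.

Let uE' := (ulift_addE, uE).

Lemma umulA : associative umul.
Proof. by move=> r s t; apply: uenv_eq => B f rf; rewrite !uE' // mulrA. Qed.
Lemma umul1l : left_id uone umul.
Proof. by move=> r; apply: uenv_eq => B f rf; rewrite !uE' // mul1r. Qed.
Lemma umul1r : right_id uone umul.
Proof. by move=> r; apply: uenv_eq => B f rf; rewrite !uE' // mulr1. Qed.
Lemma umulDl : left_distributive umul +%R.
Proof. by move=> r s t; apply: uenv_eq => B f rf; rewrite !uE' // mulrDl. Qed.
Lemma umulDr : right_distributive umul +%R.
Proof. by move=> r s t; apply: uenv_eq => B f rf; rewrite !uE' // mulrDr. Qed.

Lemma trivial_rep : lie_rep (fun _ : g => 0 : k^o).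
Proof. by split=> [a u v|u v]; rewrite ?mulr0 ?subrr // scaler0 addr0. Qed.

Lemma uone_neq0 : uone != 0.
Proof.
apply/eqP => /(congr1 (ulift (fun _ : g => 0 : k^o))).
by rewrite ulift_uone ?ulift_nil; try exact: trivial_rep; apply/eqP/oner_neq0.
Qed.
HB.instance Definition _ := GRing.Zmodule_isNzRing.Build uenv
  umulA umul1l umul1r umulDl umulDr uone_neq0.

Lemma uscaleA a b s : uscale a (uscale b s) = uscale (a * b) s.
Proof. by apply: uenv_eq => B f rf; rewrite !uE' // scalerA. Qed.
Lemma uscale1 : left_id 1 uscale.
Proof. by move=> s; apply: uenv_eq => B f rf; rewrite !uE' // scale1r. Qed.
Lemma uscaleDr : right_distributive uscale +%R.
Proof. by move=> a s t; apply: uenv_eq => B f rf; rewrite !uE' // scalerDr. Qed.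
Lemma uscaleDl s : {morph uscale^~ s : a b / a + b}.
Proof. by move=> a b; apply: uenv_eq => B f rf; rewrite !uE' // scalerDl. Qed.
HB.instance Definition _ :=
  GRing.Zmodule_isLmodule.Build k uenv uscaleA uscale1 uscaleDr uscaleDl.

Lemma uscaleAl (a : k) (u v : uenv) : a *: (u * v) = (a *: u) * v.
Proof.
apply: (uenv_eq (u := uscale a (umul u v)) (v := umul (uscale a u) v)) => B f rf.
by rewrite !uE // scalerAl.
Qed.
HB.instance Definition _ := GRing.Lmodule_isLalgebra.Build k uenv uscaleAl.

Lemma uscaleAr (a : k) (u v : uenv) : a *: (u * v) = u * (a *: v).
Proof.
apply: (uenv_eq (u := uscale a (umul u v)) (v := umul u (uscale a v))) => B f rf.
by rewrite !uE // scalerAr.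
Qed.
HB.instance Definition _ := GRing.Lalgebra_isAlgebra.Build k uenv uscaleAr.

Section UniversalProperty.
Variables (B : algType k) (f : g -> B).
Hypothesis rf : lie_rep f.

Lemma uliftD u v : ulift f (u + v) = ulift f u + ulift f v.
Proof. exact: ulift_uadd. Qed.
Lemma uliftZ a u : ulift f (a *: u) = a *: ulift f u.
Proof. exact: ulift_uscale. Qed.
Lemma ulift0 : ulift f 0 = 0.
Proof. exact: ulift_nil. Qed.
Lemma ulift1 : ulift f 1 = 1.
Proof. exact: ulift_uone. Qed.
Lemma uliftM u v : ulift f (u * v) = ulift f u * ulift f v.
Proof. exact: ulift_umul. Qed.
Lemma ulift_linear : linear (ulift f).
Proof. by move=> a u v; rewrite uliftD uliftZ. Qed.
Lemma ulift_in v : ulift f (uin v) = f v.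
Proof. by rewrite ulift_pi // /ueval big_seq1 big_seq1 scale1r. Qed.

End UniversalProperty.

Lemma uin_rep : lie_rep uin.
Proof.
split=> [a u v|u v]; apply: uenv_eq => B f rf; have [fl fM] := rf.
  by rewrite uliftD // uliftZ // !ulift_in // fl.
by rewrite -scaleN1r uliftD // uliftZ // !uliftM // !ulift_in // scaleN1r fM.
Qed.

Lemma upi_sum s : upi s = \sum_(p <- s) p.1 *: \prod_(v <- p.2) uin v.
Proof.
apply: uenv_eq => B f rf; rewrite ulift_pi //.
have Dm : {morph ulift f : u v / u + v} by move=> u v; apply: uliftD.
have Mm : {morph ulift f : u v / u * v} by move=> u v; apply: uliftM.
rewrite (big_morph _ Dm (ulift0 rf)); apply: eq_bigr => p _.
rewrite uliftZ // (big_morph _ Mm (ulift1 rf)); congr (_ *: _).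
by apply: eq_bigr => v _; rewrite ulift_in.
Qed.

Lemma ulift_unique (B : algType k) (F : {lrmorphism uenv -> B}) u :
  F u = ulift (F \o uin) u.
Proof.
have [uinl uinM] := uin_rep.
have rF : lie_rep (F \o uin).
  by split=> [a v w|v w] /=; rewrite ?uinl ?linearP // uinM rmorphB !rmorphM.
elim/uenv_rep: u => s.
rewrite ulift_pi // upi_sum linear_sum; apply: eq_bigr => p _.
by rewrite linearZ /= rmorph_prod.
Qed.

End Enveloping.

Definition umap (k : fieldType) (g h : lieType k) (f : g -> h) : uenv g -> uenv h :=
  ulift (fun v => uin (f v)).

Lemma umap_rep (k : fieldType) (g h : lieType k) (f : g -> h) :
  lie_morph f -> lie_rep (fun v => uin (f v)).
Proof.
have [ul uM] := uin_rep h.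
by case=> fl fM; split=> [a u v|u v]; rewrite ?fl ?ul // fM uM.
Qed.

(* The Hopf algebra structure of U(g): the elements of g are primitive.        *)
Section Hopf.
Variables (k : fieldType) (g : lieType k).
Notation U := (uenv g).

Definition counit : U -> k := @ulift k g k^o (fun _ => 0).

Lemma counit_linear (a : k) u v : counit (a *: u + v) = a * counit u + counit v.
Proof. exact: (ulift_linear (trivial_rep g)). Qed.
Lemma counitM u v : counit (u * v) = counit u * counit v.
Proof. exact: (uliftM (trivial_rep g)). Qed.
Lemma counit1 : counit 1 = 1.
Proof. exact: (ulift1 (trivial_rep g)). Qed.
Lemma counit0 : counit 0 = 0.
Proof. exact: (ulift0 (trivial_rep g)). Qed.

Lemma counit_bilin : bilin (fun u v : U => counit u * counit v : k^o).
Proof.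
split=> [v a u w|v a u w]; rewrite counit_linear ?mulrDl ?mulrDr.
  by rewrite -mulrA.
by rewrite mulrCA.
Qed.

Lemma utens_oner_neq0 : 1 != 0 :> tens U U.
Proof.
apply/eqP => /(congr1 (tlift (fun u v : U => counit u * counit v : k^o))).
rewrite -[X in _ = tlift _ X](scale0r (1 : tens U U)) (tliftZ _ _ counit_bilin).
rewrite scale0r (tlift_pure _ _ counit_bilin) counit1 mulr1.
by apply/eqP/oner_neq0.
Qed.

HB.instance Definition _ :=
  GRing.PzSemiRing_isNonZero.Build (tens U U) utens_oner_neq0.

Lemma tscaleAl (a : k) (s t : tens U U) : a *: (s * t) = (a *: s) * t.
Proof. by apply: esym; apply: tmulZl. Qed.
HB.instance Definition _ := GRing.Lmodule_isLalgebra.Build k (tens U U) tscaleAl.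

Lemma tscaleAr (a : k) (s t : tens U U) : a *: (s * t) = s * (a *: t).
Proof. by apply: esym; apply: tmulZr. Qed.
HB.instance Definition _ := GRing.Lalgebra_isAlgebra.Build k (tens U U) tscaleAr.

Definition coprod : U -> tens U U := ulift (fun v => uin v \ox 1 + 1 \ox uin v).

Lemma coprod_rep : lie_rep (fun v : g => uin v \ox 1 + 1 \ox uin v : tens U U).
Proof.
have [ul uM] := uin_rep g.
split=> [a u v|u v]; first by rewrite ul tpurel tpurer scalerDr addrACA.
rewrite uM !mulrDl !mulrDr !tmulE !mulr1 !mul1r.
have dl (x y : U) : (x - y) \ox 1 = x \ox 1 - y \ox 1 :> tens U U.
  by rewrite [x - y]addrC -scaleN1r tpurel scaleN1r addrC.
have dr (x y : U) : 1 \ox (x - y) = 1 \ox x - 1 \ox y :> tens U U.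
  by rewrite [x - y]addrC -scaleN1r tpurer scaleN1r addrC.
rewrite dl dr; set X := uin u \ox uin v; set Y := uin v \ox uin u.
set P := _ \ox 1; set Q := _ \ox 1; set R := 1 \ox _; set S := 1 \ox _.
rewrite [Y + _]addrC [P + X + _]addrACA [X + S]addrC [Q + Y + _]addrACA.
by rewrite [Y + X]addrC opprD [RHS]addrACA subrr addr0 opprD addrACA.
Qed.

End Hopf.

HB.instance Definition _ (k : fieldType) (A : algType k) := GRing.Lmodule.on A^c.

HB.instance Definition _ (k : fieldType) (A : algType k) :=
  GRing.Lmodule_isLalgebra.Build k A^c (fun a u v => @scalerAr k A a v u).
HB.instance Definition _ (k : fieldType) (A : algType k) :=
  GRing.Lalgebra_isAlgebra.Build k A^c (fun a u v => @scalerAl k A a v u).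

Section Calculi.
Variables (k : fieldType) (g : lieType k).
Notation U := (uenv g).

Definition antipode : U -> U := @ulift k g U^c (fun v => - uin v).

Lemma antipode_rep : @lie_rep k g U^c (fun v => - uin v).
Proof.
have [ul uM] := uin_rep g; split=> [a u v|u v].
  by rewrite ul opprD scalerN.
change (- uin (lie u v) = (- uin v) * (- uin u) - (- uin u) * (- uin v) :> U).
by rewrite !mulrNN uM opprB.
Qed.

(* v |-> v_(1) S(v_(3)) \ox v_(2)                                              *)
Definition adL (v : U) : tens U U :=
  tlift (fun u c => tlift (fun a b => (a * antipode c) \ox b) (coprod u)) (coprod v).

(* M is contained in the augmentation ideal, A M <= M and Ad_L(M) <= A \ox M,   *)
(* where A \ox M stands for its image in A \ox A.                              *)
Definition is_calculus (M : U -> Prop) : Prop :=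
  [/\ subspace M,
      forall u, M u -> counit u = 0,
      forall a u, M u -> M (a * u)
    & forall u, M u ->
        lspan (fun t : tens U U => exists a m, M m /\ t = a \ox m) (adL u)].

(* The augmentation ideal, the kernel of the counit.                           *)
Definition aug_pred : {pred U} := fun u => counit u == 0.

Lemma aug_submod : submod_closed aug_pred.
Proof.
split=> [|a u v /eqP u0 /eqP v0]; apply/eqP; first exact: counit0.
by rewrite counit_linear u0 v0 mulr0 addr0.
Qed.
HB.instance Definition _ := GRing.isSubmodClosed.Build k U aug_pred aug_submod.

Record aug := Aug { aug_val : U; aug_valP : aug_val \in aug_pred }.
HB.instance Definition _ := [isSub for aug_val].
HB.instance Definition _ := [Choice of aug by <:].
HB.instance Definition _ := [SubChoice_isSubLmodule of aug by <:].

Lemma aug_act_subproof (a : U) (u : aug) : a * val u \in aug_pred.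
Proof. by apply/eqP; rewrite counitM (eqP (valP u)) mulr0. Qed.
Definition aug_act a u : aug := Aug (aug_act_subproof a u).

Lemma aug_proj_subproof (a : U) : a - counit a *: 1 \in aug_pred.
Proof.
apply/eqP; rewrite addrC -scaleN1r scalerA counit_linear counit1.
by rewrite mulr1 mulN1r addNr.
Qed.
Definition aug_proj a : aug := Aug (aug_proj_subproof a).

Section OneCalculus.
Variable M : U -> Prop.

(* ker counit / M; the dimension of the calculus is that of this space.        *)
Definition invforms := quot (fun u : aug => M (val u)).

(* Well defined when M is a left ideal.                                        *)
Definition invforms_act (a : U) (q : invforms) : invforms :=
  qproj _ (aug_act a (repr q)).

(* The canonical projection on the kernel of the counit, extended by 0 to the  *)
(* line spanned by 1: Delta a - 1 \ox a lies in aug \ox U, so the differential *)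
(* does not depend on the extension.                                           *)
Definition invforms_proj (a : U) : invforms := qproj _ (aug_proj a).

Definition forms := tens invforms U.

Definition form_ract (w : forms) (c : U) : forms :=
  tlift (fun v b => v \ox (b * c)) w.

Definition form_lact (a : U) (w : forms) : forms :=
  tlift (fun a1 a2 => tlift (fun v b => invforms_act a1 v \ox (a2 * b)) w) (coprod a).

Definition form_comm (a : U) (w : forms) : forms := form_lact a w - form_ract w a.

Definition diff (a : U) : forms :=
  tlift (fun a1 a2 => invforms_proj a1 \ox a2) (coprod a - 1 \ox a).

End OneCalculus.

Definition calculus_dim (M : U -> Prop) (n : nat) : Prop := has_dim (invforms M) n.

End Calculi.

(* The Lie algebra with basis x_0, ..., x_n and brackets [x_0, x_i] = x_i,     *)
(* [x_i, x_j] = 0 for i, j >= 1, i.e. [u, v] = u_0 v - v_0 u in coordinates.   *)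
(* There are n+1 generators, so bnp k n is b_{(n+1)+}; in particular           *)
(* bnp k 1 is b_+, with H = x_0 and X = x_1.                                   *)
Section KappaMinkowski.
Variable k : fieldType.

Definition bnp (n : nat) := 'rV[k]_n.+1.
HB.instance Definition _ n := GRing.Lmodule.on (bnp n).

Definition bnp_lie n (u v : bnp n) : bnp n := u 0 0 *: v - v 0 0 *: u.

Lemma bnp_liell n (v : bnp n) : linear (fun u => bnp_lie u v).
Proof.
move=> a u w; rewrite /bnp_lie !mxE scalerDl scalerDr scalerBr !scalerA.
by rewrite [_ * a]mulrC opprD addrACA.
Qed.

Lemma bnp_liexx n (u : bnp n) : bnp_lie u u = 0.
Proof. exact: subrr. Qed.

Lemma bnp_lieC n (u v : bnp n) : bnp_lie u v = - bnp_lie v u.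
Proof. by rewrite /bnp_lie opprB. Qed.

Lemma bnp_lielr n (u : bnp n) : linear (bnp_lie u).
Proof.
move=> a v w; rewrite !(bnp_lieC u) scalerN -opprD.
by congr (- _); apply: bnp_liell.
Qed.

Lemma bnp_jacobi n (u v w : bnp n) :
  bnp_lie u (bnp_lie v w) + bnp_lie v (bnp_lie w u) + bnp_lie w (bnp_lie u v) = 0.
Proof. by apply/rowP => i; rewrite /bnp_lie !mxE; ring. Qed.

HB.instance Definition _ n := Lmodule_isLie.Build k (bnp n)
  (@bnp_liell n) (@bnp_lielr n) (@bnp_liexx n) (@bnp_jacobi n).

Definition bgen n (i : 'I_n.+1) : bnp n := delta_mx 0 i.

Lemma bgen_lie0 n (i : 'I_n) :
  lie (bgen ord0) (bgen (lift ord0 i)) = bgen (lift ord0 i).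
Proof.
by apply/rowP => j; rewrite /lie /= /bnp_lie !mxE /= mul1r mul0r subr0.
Qed.

Lemma bgen_lieS n (i j : 'I_n) :
  lie (bgen (lift ord0 i)) (bgen (lift ord0 j)) = 0.
Proof. by apply/rowP => l; rewrite /lie /= /bnp_lie !mxE /= !mul0r subr0. Qed.

(* The linear map sending x_i to y i.                                          *)
Definition bnp_map n (V : lmodType k) (y : 'I_n.+1 -> V) (u : bnp n) : V :=
  \sum_i u 0 i *: y i.

Lemma bnp_map_linear n (V : lmodType k) (y : 'I_n.+1 -> V) : linear (bnp_map y).
Proof.
move=> a u v; rewrite /bnp_map scaler_sumr -big_split; apply: eq_bigr => i _ /=.
by rewrite !mxE scalerDl scalerA.
Qed.

Lemma bnp_map_gen n (V : lmodType k) (y : 'I_n.+1 -> V) i : bnp_map y (bgen i) = y i.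
Proof.
rewrite /bnp_map (bigD1 i) //= big1 ?addr0 => [|j ji].
  by rewrite mxE !eqxx scale1r.
by rewrite mxE (negbTE ji) andbF scale0r.
Qed.

(* bnp k n is presented by the generators x_i and the above relations.         *)
Lemma bnp_presentation n (L : lieType k) (y : 'I_n.+1 -> L) :
  (forall i : 'I_n, lie (y ord0) (y (lift ord0 i)) = y (lift ord0 i)) ->
  (forall i j : 'I_n, lie (y (lift ord0 i)) (y (lift ord0 j)) = 0) ->
  lie_morph (bnp_map y) /\
  (forall f : bnp n -> L, lie_morph f -> (forall i, f (bgen i) = y i) ->
     forall u, f u = bnp_map y u).
Proof.
move=> y0 yS.
have addL (c a b : L) : lie (a + b) c = lie a c + lie b c.
  by have := liell c 1 a b; rewrite !scale1r.
have addR (c a b : L) : lie c (a + b) = lie c a + lie c b.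
  by have := lielr c 1 a b; rewrite !scale1r.
have l0 (a : L) : lie 0 a = 0.
  by have := liell a (-1) 0 0; rewrite scaler0 addr0 scaleN1r addNr.
have r0 (a : L) : lie a 0 = 0.
  by have := lielr a (-1) 0 0; rewrite scaler0 addr0 scaleN1r addNr.
have lZ c (a b : L) : lie (c *: a) b = c *: lie a b.
  by have := liell b c a 0; rewrite !addr0 l0 addr0.
have rZ c (a b : L) : lie b (c *: a) = c *: lie b a.
  by have := lielr b c a 0; rewrite !addr0 r0 addr0.
have lN (a b : L) : lie a b = - lie b a.
  apply/eqP; rewrite -addr_eq0; apply/eqP.
  by have := liexx (a + b); rewrite addL !addR !liexx add0r addr0.
split; last first.
  move=> f [fl _] fy u.
  pose F := GRing.isLinear.Build k (bnp n) L _ f fl.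
  pose fL : {linear bnp n -> L} := HB.pack f F.
  rewrite -[f u]/(fL u) {1}(row_sum_delta u) linear_sum /bnp_map.
  by apply: eq_bigr => i _; rewrite linearZ -fy.
split; first exact: bnp_map_linear.
move=> u v.
have yu w : bnp_map y w =
    w 0 0 *: y ord0 + \sum_(i < n) w 0 (lift ord0 i) *: y (lift ord0 i).
  by rewrite /bnp_map big_ord_recl.
pose tl (w : bnp n) : L := \sum_(i < n) w 0 (lift ord0 i) *: y (lift ord0 i).
have lt0 w : lie (y ord0) (tl w) = tl w.
  rewrite /tl (big_morph _ (addR (y ord0)) (r0 _)).
  by apply: eq_bigr => i _; rewrite rZ y0.
have ltt w w' : lie (tl w) (tl w') = 0.
  rewrite {1}/tl (big_morph _ (addL (tl w')) (l0 _)) big1 // => i _.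
  rewrite lZ /tl (big_morph _ (addR _) (r0 _)) big1 ?scaler0 // => j _.
  by rewrite rZ yS scaler0.
rewrite !yu -/(tl u) -/(tl v) addL !addR !lZ !rZ liexx ltt lt0 [lie (tl u) _]lN lt0.
rewrite !scaler0 add0r addr0 scalerN.
rewrite -[lie u v]/(bnp_lie u v) /bnp_lie !mxE mulrC subrr scale0r add0r.
rewrite /tl !scaler_sumr -sumrB; apply: eq_bigr => i _.
by rewrite !mxE scalerBl !scalerA.
Qed.

Definition xgen n (i : 'I_n.+1) : uenv (bnp n) := uin (bgen i).
Definition Hgen : uenv (bnp 1) := xgen ord0.
Definition Xgen : uenv (bnp 1) := xgen ord_max.

Definition natural_calculus (M : uenv (bnp 1) -> Prop) : Prop :=
  [/\ is_calculus M, calculus_dim M 2, diff M Xgen <> 0, diff M Hgen <> 0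
    & forall P : {poly k},
        diff M (horner_alg Hgen P) = form_ract (diff M Hgen) (horner_alg Hgen P^`()) /\
        diff M (horner_alg Xgen P) = form_ract (diff M Xgen) (horner_alg Xgen P^`())].

(* The ordered products x_n^(m_n) ... x_0^(m_0), extended linearly.            *)
Definition normal_order n (f : {mpoly k[n.+1]}) : uenv (bnp n) :=
  \sum_(m <- msupp f) f@_m *: \prod_(i < n.+1) xgen (rev_ord i) ^+ m (rev_ord i).

Definition kappa_relations n (N : uenv (bnp n) -> Prop) : Prop :=
  let dx i := diff N (xgen i) in
  [/\ forall a, form_comm a (dx ord0) = 0,
      forall i j : 'I_n, form_comm (xgen (lift ord0 i)) (dx (lift ord0 j)) = 0,
      forall i : 'I_n, form_comm (xgen ord0) (dx (lift ord0 i)) = dx (lift ord0 i)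
    & forall f : {mpoly k[n.+1]},
        diff N (normal_order f) =
        \sum_(mu < n.+1) form_ract (dx mu) (normal_order (f^`M(mu)))].

Definition bnp_perm n (s : 'S_n) : bnp n -> bnp n :=
  bnp_map (fun i => if unlift ord0 i is Some j then bgen (lift ord0 (s j))
                    else bgen ord0).

Definition perm_invariant n (N : uenv (bnp n) -> Prop) : Prop :=
  forall (s : 'S_n) u, N u -> N (umap (bnp_perm s) u).

Definition bnp_proj n : bnp n -> bnp 1 :=
  bnp_map (fun i => if i == ord0 then bgen ord0 else bgen ord_max).

(* The inverse image of M under the single map x_0 |-> H, x_i |-> X. The map   *)
(* identifies all x_i, i >= 1, so that, by pullback_dim below, the dimension   *)
(* of the calculus does not grow with the number of generators.                *)
Definition pullback n (M : uenv (bnp 1) -> Prop) (u : uenv (bnp n)) : Prop :=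
  M (umap (@bnp_proj n) u).

(* The common inverse image of M under all the Lie algebra maps with           *)
(* x_0 |-> H; these are x_0 |-> H, x_i |-> c_i X for arbitrary scalars c_i,    *)
(* and bnp_proj is the one with all c_i = 1.                                   *)
Definition induced n (M : uenv (bnp 1) -> Prop) (u : uenv (bnp n)) : Prop :=
  forall f : bnp n -> bnp 1,
    lie_morph f -> f (bgen ord0) = bgen ord0 -> M (umap f u).

Lemma bnp_proj_morph n : lie_morph (@bnp_proj n).
Proof.
apply: (bnp_presentation _ _).1 => [i|i j] /=; last by rewrite liexx.
by have -> : ord_max = lift ord0 (ord0 : 'I_1); [apply: val_inj | apply: bgen_lie0].
Qed.

Lemma bnp_perm_morph n (s : 'S_n) : lie_morph (bnp_perm s).
Proof.
apply: (bnp_presentation _ _).1 => [i|i j] /=; rewrite ?unlift_none !liftK.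
  exact: bgen_lie0.
exact: bgen_lieS.
Qed.

Lemma umap_counit n (u : uenv (bnp n)) :
  counit (umap (@bnp_proj n) u) = counit u.
Proof.
have rp := umap_rep (bnp_proj_morph n).
elim/uenv_rep: u => s; rewrite /umap ulift_pi // /counit ulift_pi; last first.
  exact: trivial_rep.
have rt := trivial_rep (bnp 1).
have D : {morph (@ulift _ _ k^o (fun _ : bnp 1 => 0)) : u v / u + v}.
  by move=> u v; apply: uliftD.
have M : {morph (@ulift _ _ k^o (fun _ : bnp 1 => 0)) : u v / u * v}.
  by move=> u v; apply: uliftM.
rewrite /ueval (big_morph _ D (ulift0 rt)); apply: eq_bigr => p _.
rewrite uliftZ // (big_morph _ M (ulift1 rt)); apply: (congr1 (fun z : k => p.1 * z)).
by apply: eq_bigr => v _; rewrite ulift_in.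
Qed.

Lemma umap_proj_surj n (u : uenv (bnp 1)) :
  exists u' : uenv (bnp n.+1), umap (@bnp_proj n.+1) u' = u.
Proof.
pose sec : bnp 1 -> bnp n.+1 :=
  bnp_map (fun i : 'I_2 => if i == ord0 then bgen ord0 else bgen (lift ord0 ord0)).
have secK : cancel sec (@bnp_proj n.+1).
  have [pl _] := bnp_proj_morph n.+1.
  move=> v; rewrite /sec /bnp_map !big_ord_recl big_ord0 /= addr0.
  rewrite pl -[X in _ + @bnp_proj _ X]addr0 pl.
  have -> : @bnp_proj n.+1 0 = 0.
    by have := pl (-1) 0 0; rewrite scaler0 addr0 scaleN1r addNr.
  rewrite addr0 /bnp_proj !bnp_map_gen /=.
  rewrite [RHS]row_sum_delta !big_ord_recl big_ord0 addr0; congr (_ *: _ + _ *: _).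
elim/uenv_rep: u => s; exists (upi [seq (p.1, [seq sec v | v <- p.2]) | p <- s]).
rewrite /umap ulift_pi; last exact/umap_rep/bnp_proj_morph.
rewrite /ueval big_map upi_sum; apply: eq_bigr => p _; rewrite big_map.
by congr (_ *: _); apply: eq_bigr => v _; rewrite secK.
Qed.

(* At least two generators: bnp k n.+1 is b_{(n+2)+}.                          *)
Lemma pullback_dim n M d : subspace M ->
  calculus_dim M d -> calculus_dim (@pullback n.+1 M) d.
Proof.
move=> sM [F bF].
have rp := umap_rep (bnp_proj_morph n.+1).
have ul := ulift_linear rp.
have augP (u : aug (bnp n.+1)) : umap (@bnp_proj n.+1) (val u) \in @aug_pred k (bnp 1).
  by apply/eqP; rewrite umap_counit; apply/eqP; apply: (valP u).
pose am (u : aug (bnp n.+1)) : aug (bnp 1) := Aug (augP u).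
have aml : linear am by move=> a u v; apply: val_inj; apply: ul.
pose P1 (u : aug (bnp 1)) := M (val u).
pose P2 (u : aug (bnp n.+1)) := pullback M (val u).
have s1 : subspace P1.
  by case: sM => M0 Ml; split=> // a u v; apply: Ml.
have s2 : subspace P2.
  case: sM => M0 Ml; split=> [|a u v uM vM]; rewrite /P2 /pullback /umap.
    by rewrite ulift0.
  by rewrite ul; apply: Ml.
pose phi (q : invforms (@pullback n.+1 M)) : invforms M := qproj P1 (am (repr q)).
have ampP u v : P2 (u - v) <-> P1 (am u - am v).
  rewrite -scaleN1r addrC -[am u - am v]addrC -[- am v]scaleN1r -aml.
  by [].
have phiE u : phi (qproj P2 u) = qproj P1 (am u).
  apply/qprojP/lspan_id => //; apply/ampP/(lspan_id s2).
  exact: qreprP.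
have phil : linear phi.
  move=> a q r; elim/quot_ind: q => u; elim/quot_ind: r => v.
  by rewrite -linearP !phiE aml linearP.
have [G GF FG] := bF.
have [inj] : injective phi /\ (forall q, exists r, phi r = q).
  split.
    move=> q r; elim/quot_ind: q => u; elim/quot_ind: r => v.
    rewrite !phiE => /qprojP/(lspan_id s1)/ampP h.
    by apply/qprojP/(lspan_id s2).
  elim/quot_ind=> w; have [w' w'E] := umap_proj_surj n (val w).
  have w'P : w' \in @aug_pred k (bnp n.+1).
    by apply/eqP; rewrite -umap_counit w'E; apply/eqP; apply: (valP w).
  exists (qproj P2 (Aug w'P)); rewrite phiE; congr (qproj _ _).
  exact: val_inj.
move=> /choice[psi psiK].
have psi_l : linear psi.
  by move=> a q r; apply: inj; rewrite phil !psiK.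
pose H0 : 'rV[k]_d -> invforms (@pullback n.+1 M) := psi \o F.
have Hl : linear H0 by move=> a u v; rewrite /H0 /= linearP psi_l.
pose HM := GRing.isLinear.Build k _ _ _ H0 Hl.
pose HL : {linear 'rV[k]_d -> invforms (@pullback n.+1 M)} := HB.pack H0 HM.
exists HL; exists (G \o phi) => [v|q] /=.
  by rewrite psiK GF.
by apply: inj; rewrite psiK FG.
Qed.

End KappaMinkowski.

Arguments pullback {k} n M u.
Arguments induced {k} n M u.

(* Main.v *)
From HB Require Import structures.
Require Import Defs.
From mathcomp Require Import mpoly.
From mathcomp Require Import all_boot perm all_algebra.
From mathcomp Require Import ssrcomplements ring boolp.
Import GRing.Theory.
Local Open Scope ring_scope.

Set Implicit Arguments.
Unset Strict Implicit.
Unset Printing Implicit Defensive.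

(** Write b_N for the Lie algebra with N = n+1 generators. A linear functional
    [lin_coef mu] on U(b_N) reads off the coefficient of x_mu in the linear part
    of the expression of u with x_0 ordered to the right. It is a skew derivation,
    D_mu(uv) = chi_mu(u) D_mu(v) + D_mu(u) eps(v), where the character chi_mu is
    eps for mu = 0 and sends x_0 to 1 and x_i to 0 for mu >= 1. In other words
    the matrices [[chi_mu, D_mu], [0, eps]] form a two-dimensional
    representation, which is how D_mu is constructed ([pd_mx_rep]).

    The common kernel of eps and of all D_mu is a left ideal, [kappa_ideal]. It
    is complementary to the span of the x_mu in ker eps, so its calculus has
    dimension N with basis the classes of the x_mu ([kappa_ideal_dim]). As U(g)
    is cocommutative, Ad_L(u) = 1 \ox u, and every left ideal in ker eps
    defines a calculus ([adL_triv]).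

    Contracting the first leg of the coproduct with D_mu and with chi_mu gives
    operators [pd mu] and [shift mu] on U(b_N): the first is a derivation
    twisted by the second, and the second is the algebra automorphism
    x_0 |-> x_0 + 1 for mu >= 1, the identity for mu = 0. For a left ideal that
    contains [kappa_ideal] the structure of the calculus is then
      du = sum_mu dx_mu (pd mu u),  a dx_mu - dx_mu a = dx_mu (shift mu a - a)
    ([diff_pd], [form_comm_xgen]). The commutation relations follow at once. The
    formula for the differential follows because [pd mu] acts on ordered
    monomials as the partial derivative: all the factors standing to the left
    of x_mu are fixed by [shift mu] ([pd_word]).

    A Lie map f that fixes x_0 carries the linear part of u to that of its image
    ([umap_lin_part]). So the inverse image of the ideal of U(b_+) under f
    consists of the u in ker eps whose linear part f kills. The intersection
    over all such f is [kappa_ideal] of U(b_N) ([inducedE]), and the single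
    inverse image under x_i |-> X is a left ideal containing it.

    For uniqueness, the conditions on d(X^2) and d(H^2) put X^2 and H^2 in the
    left ideal M of a natural calculus, and dX, dH nonzero makes X and H
    independent modulo M ([natural_indep]). Since ker eps / M is a plane,
    XH = x X + y H modulo M; multiplying this by H on the left forces x = y = 0
    ([natural_XH]). With X^2, H^2 and XH in M every u agrees modulo M with
    eps(u) plus its linear part, whence M = [kappa_ideal]. *)

(** * Linear maps, subspaces and tensors *)

(** The maps on quotients, tensor products and enveloping algebras are known to
    be linear only through propositions; the following lemmas give the usual
    consequences without building bundled morphisms. *)
Section LinearMaps.
Variables (k : fieldType) (V W : lmodType k) (f : V -> W).
Hypothesis fl : linear f.

Lemma linear_at0 : f 0 = 0.
Proof. by have := fl (-1) 0 0; rewrite scaler0 addr0 scaleN1r addNr. Qed.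

Lemma linear_atD u v : f (u + v) = f u + f v.
Proof. by have := fl 1 u v; rewrite !scale1r. Qed.

Lemma linear_atZ a u : f (a *: u) = a *: f u.
Proof. by have := fl a u 0; rewrite !addr0 linear_at0 addr0. Qed.

Lemma linear_atN u : f (- u) = - f u.
Proof. by rewrite -scaleN1r linear_atZ scaleN1r. Qed.

Lemma linear_atB u v : f (u - v) = f u - f v.
Proof. by rewrite linear_atD linear_atN. Qed.

Lemma linear_at_sum (I : Type) (r : seq I) (P : pred I) (F : I -> V) :
  f (\sum_(i <- r | P i) F i) = \sum_(i <- r | P i) f (F i).
Proof. exact: (big_morph _ linear_atD linear_at0). Qed.

End LinearMaps.

Lemma linear_add (k : fieldType) (V W : lmodType k) (f h : V -> W) :
  linear f -> linear h -> linear (fun v => f v + h v).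
Proof. by move=> fl hl a u v; rewrite fl hl scalerDr addrACA. Qed.

Lemma linear_opp (k : fieldType) (V W : lmodType k) (f : V -> W) :
  linear f -> linear (fun v => - f v).
Proof. by move=> fl a u v; rewrite fl opprD scalerN. Qed.

Lemma linear_mull (k : fieldType) (V : lmodType k) (A : algType k) (c : A)
    (f : V -> A) : linear f -> linear (fun v => c * f v).
Proof. by move=> fl a u v; rewrite fl mulrDr -scalerAr. Qed.

Lemma linear_mulr (k : fieldType) (V : lmodType k) (A : algType k) (c : A)
    (f : V -> A) : linear f -> linear (fun v => f v * c).
Proof. by move=> fl a u v; rewrite fl mulrDl -scalerAl. Qed.

Section Subspaces.
Variables (k : fieldType) (V : lmodType k) (N : V -> Prop).
Hypothesis sN : subspace N.

Lemma subspace0 : N 0. Proof. by case: sN. Qed.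

Lemma subspaceZ a u : N u -> N (a *: u).
Proof. by case: sN => N0 Nl uN; rewrite -[_ *: _]addr0; apply: Nl. Qed.

Lemma subspaceD u v : N u -> N v -> N (u + v).
Proof. by case: sN => N0 Nl uN vN; rewrite -[u]scale1r; apply: Nl. Qed.

Lemma subspaceB u v : N u -> N v -> N (u - v).
Proof. by move=> uN vN; rewrite -scaleN1r; apply/subspaceD/subspaceZ. Qed.

End Subspaces.

Lemma tens_ext (k : fieldType) (V W Z : lmodType k) (S T : tens V W -> Z) :
  linear S -> linear T -> (forall v w, S (v \ox w) = T (v \ox w)) -> S =1 T.
Proof.
move=> Sl Tl ST; elim/tens_ind=> [|v w s IHs]; first by rewrite !linear_at0.
by rewrite !linear_atD // IHs ST.
Qed.

Lemma tpureZl (k : fieldType) (V W : lmodType k) a (v : V) (w : W) :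
  (a *: v) \ox w = a *: (v \ox w).
Proof. by rewrite (linear_atZ (tpurel w)). Qed.

Lemma tpureZr (k : fieldType) (V W : lmodType k) a (v : V) (w : W) :
  v \ox (a *: w) = a *: (v \ox w).
Proof. by rewrite (linear_atZ (tpurer v)). Qed.

(** * Enveloping algebras: coproduct, antipode and adjoint coaction *)

Section EnvelopingAlgebra.
Variables (k : fieldType) (g : lieType k).
Notation U := (uenv g).

Lemma uin_linear : linear (@uin k g). Proof. by case: (uin_rep g). Qed.

Lemma uin_comm x y : uin x * uin y = uin y * uin x + uin (lie x y) :> U.
Proof. by case: (uin_rep g) => _ ->; rewrite addrC subrK. Qed.

(** Words in g span the enveloping algebra, so it is generated from 1 by left
    multiplication with elements of g. *)
Lemma uenv_ind (P : U -> Prop) :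
    P 1 -> (forall a u v, P u -> P v -> P (a *: u + v)) ->
    (forall x u, P u -> P (uin x * u)) ->
  forall u, P u.
Proof.
move=> P1 Pl Px; have P0 : P 0 by rewrite -[0](addNr 1) -scaleN1r; apply: Pl.
elim/uenv_rep=> s; rewrite upi_sum; elim: s => [|[a w] s IHs].
  by rewrite big_nil.
rewrite big_cons /=; apply: Pl => //.
by elim: w => [|x w IHw]; rewrite ?big_nil ?big_cons //; apply: Px.
Qed.

Lemma counit_lin : linear (@counit k g : U -> k^o).
Proof. exact: counit_linear. Qed.

Lemma counit_uin x : counit (uin x : U) = 0.
Proof. exact: (ulift_in (trivial_rep g)). Qed.

Lemma coprod_linear : linear (@coprod k g).
Proof. exact: (ulift_linear (coprod_rep g)). Qed.

Lemma coprod1 : @coprod k g 1 = 1 \ox 1.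
Proof. exact: (ulift1 (coprod_rep g)). Qed.

Lemma coprodM u v : @coprod k g (u * v) = coprod u * coprod v.
Proof. exact: (uliftM (coprod_rep g)). Qed.

Lemma coprod_uin x : @coprod k g (uin x) = uin x \ox 1 + 1 \ox uin x.
Proof. exact: (ulift_in (coprod_rep g)). Qed.

Lemma antipode_linear : linear (@antipode k g).
Proof. exact: (ulift_linear (antipode_rep g)). Qed.

Lemma antipode1 : @antipode k g 1 = 1.
Proof. exact: (ulift1 (antipode_rep g)). Qed.

Lemma antipode_uinM x u : @antipode k g (uin x * u) = - (antipode u * uin x).
Proof.
rewrite -mulrN [LHS](uliftM (antipode_rep g)).
by congr (antipode u * _); rewrite (ulift_in (antipode_rep g)).
Qed.

(* [R c] is a \ox b |-> a S(c) \ox b, the inner contraction in [adL]. *)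
Let R (c : U) : tens U U -> tens U U :=
  tlift (fun a b => (a * antipode c) \ox b).

Let R_bilin c : bilin (fun a b : U => (a * antipode c) \ox b).
Proof.
split=> [b a u v|a x u v]; last by rewrite tpurer.
by rewrite mulrDl -scalerAl tpurel.
Qed.

Let R_linear c : linear (R c).
Proof. exact/tlift_linear/R_bilin. Qed.

Let T_bilin : bilin (fun u c : U => R c (coprod u)).
Proof.
split=> [c a u v|u a c d]; first by rewrite coprod_linear R_linear.
apply: (@tens_ext _ _ _ _ (R (a *: c + d))
  (fun s => a *: R c s + R d s)) => [|b s t|v w] /=.
- exact: R_linear.
- by rewrite !R_linear !scalerDr !scalerA mulrC addrACA.
rewrite /R !tlift_pure; do ?exact: R_bilin.
by rewrite antipode_linear mulrDr -scalerAr tpurel.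
Qed.

(** Cocommutativity gives v_(1) S(v_(3)) \ox v_(2) = v_(1) S(v_(2)) \ox v_(3),
    which is 1 \ox v by the antipode axiom. The proof avoids both facts: for x
    in g one computes directly that
    Ad(xv) = (x \ox 1) Ad(v) + (1 \ox x) Ad(v) - Ad(v) (x \ox 1),
    and the outer two terms cancel when Ad(v) = 1 \ox v. *)
Lemma adL_triv (u : U) : adL u = 1 \ox u.
Proof.
have Rx c x s : R c (coprod (uin x) * s) =
    (uin x \ox 1 : tens U U) * R c s + (1 \ox uin x) * R c s.
  rewrite coprod_uin.
  apply: (@tens_ext _ _ _ _
    (fun s => R c ((uin x \ox 1 + 1 \ox uin x) * s))
    (fun s => (uin x \ox 1 : tens U U) * R c s + (1 \ox uin x) * R c s))
    => [a t v||v w].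
  - by rewrite mulrDr -scalerAr R_linear.
  - by apply: linear_add; apply: linear_mull; apply: R_linear.
  rewrite mulrDl !tmulE (linear_atD (R_linear c)) /R !tlift_pure;
    do ?exact: R_bilin.
  by rewrite !tmulE !mul1r !mulrA.
have RS c x s : R (uin x * c) s = - (R c s * (uin x \ox 1)).
  apply: (@tens_ext _ _ _ _ (R (uin x * c))
    (fun s => - (R c s * (uin x \ox 1)))) => [||v w].
  - exact: R_linear.
  - exact/linear_opp/linear_mulr/R_linear.
  rewrite /R !tlift_pure; do ?exact: R_bilin.
  rewrite tmulE antipode_uinM mulrN mulr1 (linear_atN (tpurel _)).
  by rewrite mulrA.
pose T := tlift (fun u c : U => R c (coprod u)).
have T_linear : linear T by apply/tlift_linear/T_bilin.
have Tx x t : T (coprod (uin x) * t) =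
    (uin x \ox 1) * T t + (1 \ox uin x) * T t - T t * (uin x \ox 1).
  rewrite coprod_uin.
  apply: (@tens_ext _ _ _ _
    (fun t => T ((uin x \ox 1 + 1 \ox uin x) * t))
    (fun t => (uin x \ox 1) * T t + (1 \ox uin x) * T t - T t * (uin x \ox 1)))
    => [a s v||v w].
  - by rewrite mulrDr -scalerAr T_linear.
  - apply: linear_add; last exact/linear_opp/linear_mulr.
    by apply: linear_add; apply: linear_mull.
  rewrite mulrDl !tmulE (linear_atD T_linear) /T !tlift_pure; do ?exact: T_bilin.
  by rewrite !mul1r coprodM Rx RS.
rewrite -[adL u]/(T (coprod u)); move: u; apply: uenv_ind => [|a u v IHu IHv|x u IHu].
- rewrite coprod1 /T tlift_pure; last exact: T_bilin.
  rewrite coprod1 /R tlift_pure; last exact: R_bilin.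
  by rewrite antipode1 mulr1.
- by rewrite coprod_linear T_linear IHu IHv tpurer.
rewrite coprodM Tx IHu !tmulE !mulr1 !mul1r.
by rewrite addrAC subrr add0r.
Qed.

Lemma left_ideal_calculus (N : U -> Prop) :
    subspace N -> (forall u, N u -> counit u = 0) ->
    (forall a u, N u -> N (a * u)) ->
  is_calculus N.
Proof.
move=> sN N0 NM; split=> // u uN; rewrite adL_triv.
by apply: lspan_incl; exists 1, u.
Qed.

End EnvelopingAlgebra.

(** * Contracting one leg of the coproduct *)

Section Contraction.
Variables (k : fieldType) (g : lieType k).
Notation U := (uenv g).

Definition contrl (phi : U -> k) (t : tens U U) : U :=
  tlift (fun a b => phi a *: b) t.

Definition contrr (phi : U -> k) (t : tens U U) : U :=
  tlift (fun a b => phi b *: a) t.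

Section Linear.
Variable phi : U -> k.
Hypothesis phi_lin : linear (phi : U -> k^o).

Let contrl_bilin : bilin (fun a b : U => phi a *: b).
Proof.
split=> [b x u v|a x u v]; first by rewrite phi_lin scalerDl scalerA.
by rewrite scalerDr !scalerA mulrC.
Qed.

Let contrr_bilin : bilin (fun a b : U => phi b *: a).
Proof.
split=> [b x u v|a x u v]; first by rewrite scalerDr !scalerA mulrC.
by rewrite phi_lin scalerDl scalerA.
Qed.

Lemma contrl_linear : linear (contrl phi).
Proof. exact/tlift_linear/contrl_bilin. Qed.

Lemma contrl_pure a b : contrl phi (a \ox b) = phi a *: b.
Proof. exact/tlift_pure/contrl_bilin. Qed.

Lemma contrr_linear : linear (contrr phi).
Proof. exact/tlift_linear/contrr_bilin. Qed.

Lemma contrr_pure a b : contrr phi (a \ox b) = phi b *: a.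
Proof. exact/tlift_pure/contrr_bilin. Qed.

Lemma contrl_mul :
    {morph phi : a b / a * b >-> a * b} ->
  {morph contrl phi : s t / s * t >-> s * t}.
Proof.
move=> phiM s t; move: s.
apply: (@tens_ext _ _ _ _ (fun s => contrl phi (s * t))
  (fun s => contrl phi s * contrl phi t)) => [x a b||a b].
- by rewrite mulrDl -scalerAl contrl_linear.
- exact/linear_mulr/contrl_linear.
move: t; apply: (@tens_ext _ _ _ _ (fun t => contrl phi ((a \ox b) * t))
  (fun t => contrl phi (a \ox b) * contrl phi t)) => [x s t||c d].
- by rewrite mulrDr -scalerAr contrl_linear.
- exact/linear_mull/contrl_linear.
by rewrite tmulE !contrl_pure phiM -scalerAl -scalerAr scalerA.
Qed.

Lemma contrr_mul :
    {morph phi : a b / a * b >-> a * b} ->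
  {morph contrr phi : s t / s * t >-> s * t}.
Proof.
move=> phiM s t; move: s.
apply: (@tens_ext _ _ _ _ (fun s => contrr phi (s * t))
  (fun s => contrr phi s * contrr phi t)) => [x a b||a b].
- by rewrite mulrDl -scalerAl contrr_linear.
- exact/linear_mulr/contrr_linear.
move: t; apply: (@tens_ext _ _ _ _ (fun t => contrr phi ((a \ox b) * t))
  (fun t => contrr phi (a \ox b) * contrr phi t)) => [x s t||c d].
- by rewrite mulrDr -scalerAr contrr_linear.
- exact/linear_mull/contrr_linear.
by rewrite tmulE !contrr_pure phiM -scalerAl -scalerAr scalerA.
Qed.

End Linear.

(** After the coproduct, this turns a skew derivation of U(g) with values in k
    into a twisted derivation of U(g). *)
Lemma contrl_skew (chi D : U -> k) :
    linear (chi : U -> k^o) -> linear (D : U -> k^o) ->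
    (forall a b, D (a * b) = chi a * D b + D a * counit b) ->
  forall s t, contrl D (s * t) =
    contrl chi s * contrl D t + contrl D s * contrl (@counit k g) t.
Proof.
move=> chil Dl DM s t; have el := @counit_lin k g; move: s.
apply: (@tens_ext _ _ _ _ (fun s => contrl D (s * t))
  (fun s => contrl chi s * contrl D t + contrl D s * contrl (@counit k g) t))
  => [x a b||a b].
- by rewrite mulrDl -scalerAl contrl_linear.
- by apply: linear_add; apply/linear_mulr/contrl_linear.
move: t; apply: (@tens_ext _ _ _ _ (fun t => contrl D ((a \ox b) * t))
  (fun t => contrl chi (a \ox b) * contrl D t
     + contrl D (a \ox b) * contrl (@counit k g) t)) => [x s t||c d].
- by rewrite mulrDr -scalerAr contrl_linear.
- by apply: linear_add; apply/linear_mull/contrl_linear.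
rewrite tmulE !contrl_pure // DM scalerDl.
by rewrite -!scalerAl -!scalerAr !scalerA.
Qed.

(** Both sides are algebra maps that agree on g. *)
Lemma contrl_counit u : contrl (@counit k g) (coprod u) = u.
Proof.
have el := @counit_lin k g; have cl := contrl_linear el.
move: u; apply: uenv_ind => [|a u v IHu IHv|x u IHu].
- by rewrite coprod1 contrl_pure // counit1 scale1r.
- by rewrite coprod_linear cl IHu IHv.
rewrite coprodM (contrl_mul el (@counitM _ _)) IHu coprod_uin (linear_atD cl).
by rewrite !contrl_pure // counit_uin counit1 scale0r scale1r add0r.
Qed.

Lemma contrr_counit u : contrr (@counit k g) (coprod u) = u.
Proof.
have el := @counit_lin k g; have cl := contrr_linear el.
move: u; apply: uenv_ind => [|a u v IHu IHv|x u IHu].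
- by rewrite coprod1 contrr_pure // counit1 scale1r.
- by rewrite coprod_linear cl IHu IHv.
rewrite coprodM (contrr_mul el (@counitM _ _)) IHu coprod_uin (linear_atD cl).
by rewrite !contrr_pure // counit_uin counit1 scale0r scale1r addr0.
Qed.

End Contraction.

(** * Twisted partial derivatives on the enveloping algebra *)

Section PartialDerivatives.
Variables (k : fieldType) (n : nat).
Notation U := (uenv (bnp k n)).
Implicit Types (mu nu : 'I_n.+1) (u v : U) (x : bnp k n).

(** The upper right entry of a product of upper triangular matrices obeys a
    skew Leibniz rule; representing b_N in such matrices is the way to produce a
    functional with that rule, since enveloping algebras only come with a
    universal property. *)
Definition pd_mx mu x : 'M[k]_2 :=
  \matrix_(i, j) if i == 0 then
                   if j == 0 then (mu != ord0)%:R * x 0 0 else x 0 mu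
                 else 0.

Let m2E (A B : 'M[k]_2) i j : (A * B) i j = A i 0 * B 0 j + A i 1 * B 1 j.
Proof.
rewrite mxE !big_ord_recl big_ord0 addr0.
by congr (_ + A i _ * B _ j); apply: val_inj.
Qed.

(** In the corner, [x, y] has coordinate x_0 y_mu - y_0 x_mu. For mu >= 1 this
    is the commutator of the matrices; for mu = 0 both vanish. *)
Lemma pd_mx_rep mu : lie_rep (pd_mx mu).
Proof.
split=> [a x y|x y]; apply/matrixP=> i j.
  rewrite !mxE; case: ifP => _; last by rewrite mulr0 addr0.
  by case: ifP => _; rewrite ?mulrDr ?mulrA // [_ * a]mulrC.
have subE (A B : 'M[k]_2) : (A - B) i j = A i j - B i j by rewrite !mxE.
rewrite subE !m2E !mxE /=.
case: ifP => _ /=; last by rewrite !mul0r !addr0 subr0.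
case: ifP => _ /=; first by rewrite !mulr0 !addr0; ring.
case: (eqVneq mu ord0) => [->|_] /=; rewrite ?mul1r !mulr0 !addr0 //.
by rewrite !mul0r subr0 mulrC subrr.
Qed.

Definition pd_hom mu : U -> 'M[k]_2 := ulift (pd_mx mu).

(** [chi mu], [lin_coef mu] and the counit are the three entries of the triangular
    representation; the last one is identified in [pd_hom_bottom]. *)
Definition chi mu u : k := pd_hom mu u 0 0.

Definition lin_coef mu u : k := pd_hom mu u 0 1.

Lemma pd_hom_linear mu : linear (pd_hom mu).
Proof. exact/ulift_linear/pd_mx_rep. Qed.

Lemma pd_hom1 mu : pd_hom mu 1 = 1.
Proof. exact/ulift1/pd_mx_rep. Qed.

Lemma pd_homM mu u v : pd_hom mu (u * v) = pd_hom mu u * pd_hom mu v.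
Proof. exact/uliftM/pd_mx_rep. Qed.

Lemma pd_hom_uin mu x : pd_hom mu (uin x) = pd_mx mu x.
Proof. exact/ulift_in/pd_mx_rep. Qed.

Lemma pd_hom_bottom mu u : pd_hom mu u 1 0 = 0 /\ pd_hom mu u 1 1 = counit u.
Proof.
move: u; apply: uenv_ind => [|a u v [u0 u1] [v0 v1]|x u [u0 u1]].
- by rewrite pd_hom1 counit1 !mxE.
- by rewrite pd_hom_linear counit_linear !mxE u0 u1 v0 v1 mulr0 addr0.
rewrite pd_homM pd_hom_uin !m2E u0 u1 !mxE /= counitM counit_uin.
by rewrite !mul0r addr0.
Qed.

Lemma chi_linear mu : linear (chi mu : U -> k^o).
Proof. by move=> a u v; rewrite /chi pd_hom_linear !mxE. Qed.

Lemma chi1 mu : chi mu 1 = 1.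
Proof. by rewrite /chi pd_hom1 mxE. Qed.

Lemma chiM mu : {morph chi mu : u v / u * v >-> u * v}.
Proof.
move=> u v; rewrite /chi pd_homM m2E; have [-> _] := pd_hom_bottom mu v.
by rewrite mulr0 addr0.
Qed.

Lemma chi_uin mu x : chi mu (uin x) = (mu != ord0)%:R * x 0 0.
Proof. by rewrite /chi pd_hom_uin mxE. Qed.

Lemma lin_coef_linear mu : linear (lin_coef mu : U -> k^o).
Proof. by move=> a u v; rewrite /lin_coef pd_hom_linear !mxE. Qed.

Lemma lin_coef1 mu : lin_coef mu 1 = 0.
Proof. by rewrite /lin_coef pd_hom1 mxE. Qed.

Lemma lin_coefM mu u v :
  lin_coef mu (u * v) = chi mu u * lin_coef mu v + lin_coef mu u * counit v.
Proof.
by rewrite /lin_coef pd_homM m2E; have [_ ->] := pd_hom_bottom mu v.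
Qed.

Lemma lin_coef_uin mu x : lin_coef mu (uin x) = x 0 mu.
Proof. by rewrite /lin_coef pd_hom_uin mxE. Qed.

Lemma chi0 u : chi ord0 u = counit u.
Proof.
move: u; apply: uenv_ind => [|a u v IHu IHv|x u IHu].
- by rewrite chi1 counit1.
- by rewrite chi_linear counit_linear IHu IHv.
by rewrite chiM counitM IHu chi_uin counit_uin eqxx mul0r.
Qed.

Definition shift mu u : U := contrl (chi mu) (coprod u).

Definition pd mu u : U := contrl (lin_coef mu) (coprod u).

Lemma shiftM mu : {morph shift mu : u v / u * v}.
Proof.
move=> u v; rewrite /shift coprodM.
exact: (contrl_mul (@chi_linear mu) (@chiM mu)).
Qed.

Lemma shift1 mu : shift mu 1 = 1.
Proof.
by rewrite /shift coprod1 contrl_pure ?chi1 ?scale1r //; apply: chi_linear.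
Qed.

Lemma shift_uin mu x : shift mu (uin x) = uin x + (chi mu (uin x))%:A.
Proof.
have cl := @chi_linear mu.
rewrite /shift coprod_uin (linear_atD (contrl_linear cl)) !contrl_pure //.
by rewrite chi1 scale1r addrC.
Qed.

Lemma shift0 u : shift ord0 u = u.
Proof.
rewrite -[RHS]contrl_counit /shift; apply: tlift_ext => a b.
by rewrite chi0.
Qed.

Lemma pd_linear mu : linear (pd mu).
Proof.
by move=> a u v; rewrite /pd coprod_linear (contrl_linear (@lin_coef_linear mu)).
Qed.

Lemma pd1 mu : pd mu 1 = 0.
Proof.
rewrite /pd coprod1 contrl_pure ?lin_coef1 ?scale0r //.
exact: lin_coef_linear.
Qed.

Lemma pdM mu u v : pd mu (u * v) = shift mu u * pd mu v + pd mu u * v.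
Proof.
rewrite /pd coprodM (contrl_skew (@chi_linear mu) (@lin_coef_linear mu)).
  by rewrite contrl_counit.
exact: lin_coefM.
Qed.

Lemma pd_uin mu x : pd mu (uin x) = (x 0 mu)%:A.
Proof.
have cl := @lin_coef_linear mu.
rewrite /pd coprod_uin (linear_atD (contrl_linear cl)) !contrl_pure //.
by rewrite lin_coef1 scale0r addr0 lin_coef_uin.
Qed.

End PartialDerivatives.

(** * Forms, differential and bimodule structure of a left ideal *)

Section Calculus.
Variables (k : fieldType) (g : lieType k) (N : uenv g -> Prop).
Notation U := (uenv g).
Hypothesis sN : subspace N.

Lemma aug_subspace : subspace (fun u : aug g => N (val u)).
Proof. by case: sN => N0 Nl; split=> // a u v; apply: Nl. Qed.

Lemma invforms_proj_linear : linear (@invforms_proj k g N).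
Proof.
move=> a u v; rewrite /invforms_proj -linearP; congr (qproj _ _).
apply: val_inj => /=; rewrite counit_linear scalerDl -scalerA.
by rewrite opprD addrACA scalerBr.
Qed.

(** The projection forgets constants, so equality of classes is congruence
    modulo N only for elements with the same counit. *)
Lemma invforms_projP (u v : U) : counit u = counit v ->
  invforms_proj N u = invforms_proj N v <-> N (u - v).
Proof.
move=> uv; rewrite /invforms_proj.
have e : val (aug_proj u - aug_proj v) = u - v.
  by rewrite /= uv opprB addrA subrK.
by rewrite -e; split=> [/qprojP/(lspan_id aug_subspace)|h]; last
  exact/qprojP/(lspan_id aug_subspace).
Qed.

Lemma invforms_proj1 : invforms_proj N 1 = 0.
Proof.
rewrite /invforms_proj (_ : aug_proj 1 = 0) ?linear0 //.
by apply: val_inj; rewrite /= counit1 scale1r subrr.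
Qed.


Lemma invforms_proj_eq0 (u : U) :
  counit u = 0 -> invforms_proj N u = 0 <-> N u.
Proof.
move=> u0; rewrite -(linear_at0 invforms_proj_linear) -{2}[u]subr0.
by apply: invforms_projP; rewrite u0 counit0.
Qed.

Let ract_bilin c :
  bilin (fun (v : invforms N) (b : U) => v \ox (b * c)).
Proof.
split=> [b a u v|v a b d]; first by rewrite tpurel.
by rewrite mulrDl -scalerAl tpurer.
Qed.

Lemma form_ract_pure (v : invforms N) b c : form_ract (v \ox b) c = v \ox (b * c).
Proof. exact/tlift_pure/ract_bilin. Qed.

Lemma form_ract_linear c : linear (fun w : forms N => form_ract w c).
Proof. exact/tlift_linear/ract_bilin. Qed.

Let diff_bilin : bilin (fun a b : U => invforms_proj N a \ox b).
Proof.
split=> [b a u v|v a b d]; last by rewrite tpurer.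
by rewrite invforms_proj_linear tpurel.
Qed.

Lemma diffE (u : U) :
  diff N u = tlift (fun a b => invforms_proj N a \ox b) (coprod u).
Proof.
rewrite /diff (linear_atB (tlift_linear diff_bilin)) tlift_pure //.
by rewrite invforms_proj1 (linear_at0 (tpurel _)) subr0.
Qed.

Lemma diff_uin x : diff N (uin x) = invforms_proj N (uin x) \ox 1.
Proof.
rewrite diffE coprod_uin (linear_atD (tlift_linear diff_bilin)) !tlift_pure //.
by rewrite invforms_proj1 (linear_at0 (tpurel _)) addr0.
Qed.

(** Recovers the invariant form from a form; it makes the class of u in
    ker eps / N visible in du ([forms_counit_diff]). *)
Definition forms_counit (w : forms N) : invforms N :=
  tlift (fun v b => counit b *: v) w.

Let forms_counit_bilin : bilin (fun (v : invforms N) (b : U) => counit b *: v).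
Proof.
split=> [b a u v|v a b d]; first by rewrite scalerDr !scalerA mulrC.
by rewrite counit_linear scalerDl scalerA.
Qed.

Lemma forms_counit_linear : linear forms_counit.
Proof. exact/tlift_linear/forms_counit_bilin. Qed.

Lemma forms_counit_pure v b : forms_counit (v \ox b) = counit b *: v.
Proof. exact/tlift_pure/forms_counit_bilin. Qed.

Lemma forms_counit_ract w c :
  forms_counit (form_ract w c) = counit c *: forms_counit w.
Proof.
have fl := forms_counit_linear; move: w.
apply: (@tens_ext _ _ _ _ (fun w => forms_counit (form_ract w c))
  (fun w => counit c *: forms_counit w)) => [a v w|a v w|v b].
- by rewrite form_ract_linear fl.
- by rewrite fl scalerDr !scalerA mulrC.
by rewrite form_ract_pure !forms_counit_pure counitM scalerA mulrC.
Qed.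

Lemma forms_counit_diff u : forms_counit (diff N u) = invforms_proj N u.
Proof.
have fl := forms_counit_linear; rewrite diffE -{2}[u]contrr_counit.
move: (coprod u); apply: (@tens_ext _ _ _ _
  (fun t => forms_counit (tlift (fun a b : U => invforms_proj N a \ox b) t))
  (fun t => invforms_proj N (contrr (@counit k g) t))) => [a s t|a s t|v w].
- by rewrite (tlift_linear diff_bilin) fl.
- by rewrite (contrr_linear (@counit_lin k g)) invforms_proj_linear.
rewrite tlift_pure // forms_counit_pure contrr_pure; last exact: counit_lin.
by rewrite (linear_atZ invforms_proj_linear).
Qed.

Hypothesis NM : forall a u, N u -> N (a * u).

Lemma invforms_actE a (u : U) : counit u = 0 ->
  invforms_act a (invforms_proj N u) = invforms_proj N (a * u).
Proof.
move=> u0; apply/qprojP/(lspan_id aug_subspace).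
have := qreprP (M := fun u : aug g => N (val u)) (aug_proj u).
move=> /(lspan_id aug_subspace) /(NM a) /=.
by rewrite u0 counitM u0 mulr0 !scale0r !subr0 mulrBr.
Qed.

Lemma invforms_act_linear a : linear (@invforms_act k g N a).
Proof.
have actE u : invforms_act a (qproj (fun u : aug g => N (val u)) u) = qproj _ (aug_act a u).
  apply/qprojP/(lspan_id aug_subspace).
  have := qreprP (M := fun u : aug g => N (val u)) u.
  by move=> /(lspan_id aug_subspace) /(NM a) /=; rewrite mulrBr.
move=> c p q; elim/quot_ind: p => u; elim/quot_ind: q => v.
rewrite -linearP !actE -linearP; congr (qproj _ _).
by apply: val_inj; rewrite /= mulrDr scalerAr.
Qed.

Lemma form_lact_pure1 a (v : invforms N) :
  form_lact a (v \ox 1) =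
  tlift (fun a1 a2 : U => invforms_act a1 v \ox a2) (coprod a).
Proof.
apply: tlift_ext => b c; rewrite tlift_pure ?mulr1 //.
split=> [d x u w|u x d e]; first by rewrite invforms_act_linear tpurel.
by rewrite mulrDr -scalerAr tpurer.
Qed.

(** If the left ideal makes the class of u an eigenvector of U(g) with character
    phi, moving that form past a applies (phi \ox id) Delta to a. *)
Lemma form_lact_char (phi : U -> k) a u :
    linear (phi : U -> k^o) -> counit u = 0 ->
    (forall b, N (b * u - phi b *: u)) ->
  form_lact a (invforms_proj N u \ox 1) =
  invforms_proj N u \ox contrl phi (coprod a).
Proof.
move=> phil u0 uN; rewrite form_lact_pure1.
rewrite (tlift_ext (g := fun b c => invforms_proj N u \ox (phi b *: c))).
  set p := invforms_proj N u.
  have bl : bilin (fun b c => p \ox (phi b *: c)).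
    split=> [c x b d|b x c d].
      by rewrite phil scalerDl -scalerA tpurer.
    by rewrite !tpureZr tpurer !scalerDr !scalerA mulrC.
  move: (coprod a); apply: (@tens_ext _ _ _ _ _
    (fun t => p \ox contrl phi t)) => [||b c].
  - exact: tlift_linear.
  - by move=> x s t; rewrite contrl_linear // tpurer.
  by rewrite tlift_pure // contrl_pure.
move=> b c; rewrite tpureZr -tpureZl; congr (_ \ox _).
rewrite invforms_actE // -(linear_atZ invforms_proj_linear).
apply/invforms_projP => //.
by rewrite counitM (linear_atZ (@counit_lin k g)) u0 mulr0 scaler0.
Qed.

End Calculus.

(** * Partial derivatives of ordered monomials *)

Section NormalOrdering.
Variables (k : fieldType) (n : nat).
Implicit Types (mu nu : 'I_n.+1) (m : 'X_{1..n.+1}) (f : {mpoly k[n.+1]}).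
Local Notation X := (@xgen k n).

Lemma bgenE mu nu : bgen k nu 0 mu = (mu == nu)%:R.
Proof. by rewrite mxE eqxx. Qed.

Lemma chi_xgen mu nu : chi mu (X nu) = ((mu != ord0) && (nu == ord0))%:R.
Proof. by rewrite chi_uin bgenE -natrM mulnb [ord0 == _]eq_sym. Qed.

(** The only generator moved by a shift is x_0, and only by those with
    mu >= 1. *)
Lemma shift_xgen mu nu : (mu == ord0) || (nu != ord0) -> shift mu (X nu) = X nu.
Proof.
rewrite shift_uin chi_xgen => munu.
by rewrite -[_ && _]negbK negb_and negbK munu scale0r addr0.
Qed.

Lemma shift_exp mu nu d :
  (mu == ord0) || (nu != ord0) -> shift mu (X nu ^+ d) = X nu ^+ d.
Proof.
move=> munu; elim: d => [|d IHd]; first by rewrite expr0 shift1.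
by rewrite exprS shiftM IHd shift_xgen.
Qed.

Lemma pd_exp mu nu d :
  pd mu (X nu ^+ d) = if mu == nu then d%:R *: X nu ^+ d.-1 else 0.
Proof.
elim: d => [|d IHd]; first by rewrite expr0 pd1 scale0r if_same.
rewrite exprS pdM IHd pd_uin bgenE; case: eqP => [<-|_]; last first.
  by rewrite mulr0 scale0r mul0r addr0.
rewrite shift_xgen ?orbN // scale1r mul1r -scalerAr -nat1r scalerDl scale1r addrC.
case: d {IHd} => [|d]; first by rewrite !scale0r.
by rewrite -exprS.
Qed.

Definition word m (s : seq 'I_n.+1) : uenv (bnp k n) :=
  \prod_(nu <- s) X nu ^+ m nu.

(** Decreasing indices are what makes this work: any factor to the left of x_mu has
    an index greater than mu >= 0, hence is fixed by [shift mu], and the twisted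
    Leibniz rule differentiates the single power of x_mu in place. *)
Lemma pd_word mu m s : pairwise (fun mu nu => nu < mu)%N s ->
  pd mu (word m s) = if mu \in s then (m mu)%:R *: word (m - U_(mu))%MM s else 0.
Proof.
rewrite /word; elim: s => [|nu s IHs] /=; first by rewrite !big_nil pd1.
case/andP=> /allP nu_s s_dec; rewrite !big_cons pdM pd_exp inE (IHs s_dec).
case: (eqVneq mu nu) => [e|mu'nu] /=; first subst nu.
  have /negbTE-> : mu \notin s by apply/negP => /nu_s /=; rewrite ltnn.
  rewrite mulr0 add0r -scalerAl mnmBE mnm1E eqxx subn1; congr (_ *: (_ * _)).
  rewrite !big_seq; apply: eq_bigr => i /nu_s i_mu.
  have /negbTE mu'i : mu != i by apply: contraTneq i_mu => ->; rewrite ltnn.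
  by rewrite mnmBE mnm1E mu'i subn0.
rewrite mul0r addr0; case: ifP => [mu_s|_]; last by rewrite mulr0.
have nu_gt0 : nu != ord0.
  by apply: contraTneq (nu_s _ mu_s) => ->; rewrite ltn0.
rewrite shift_exp ?nu_gt0 ?orbT // -scalerAr mnmBE mnm1E (negbTE mu'nu).
by rewrite subn0.
Qed.

Definition descending : seq 'I_n.+1 := [seq rev_ord i | i <- enum 'I_n.+1].

Lemma descending_pairwise : pairwise (fun mu nu => nu < mu)%N descending.
Proof.
rewrite pairwise_map; apply: (@sub_pairwise _ (relpre val ltn)).
  move=> i j /= ij; apply: ltn_sub2l => //.
  by apply: leq_ltn_trans ij (ltn_ord j).
by rewrite -pairwise_map val_enum_ord -sorted_pairwise ?iota_ltn_sorted //; apply: ltn_trans.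
Qed.

Lemma mem_descending mu : mu \in descending.
Proof. by apply/mapP; exists (rev_ord mu); rewrite ?mem_enum ?rev_ordK. Qed.

Lemma normal_orderE f :
  normal_order f = \sum_(m <- msupp f) f@_m *: word m descending.
Proof.
apply: eq_bigr => m _; congr (_ *: _).
by rewrite /word /descending big_map enumT.
Qed.

(** The sum over the support is not additive term by term; summing over all
    monomials below a common degree bound is. *)
Lemma normal_order_linear : linear (@normal_order k n).
Proof.
have bound d f : (msize f <= d)%N -> normal_order f =
    \sum_(m : 'X_{1..n.+1 < d}) f@_m *: word m descending.
  move=> fd; pose I : subFinType _ := 'X_{1..n.+1 < d}.
  rewrite normal_orderE (big_mksub I) ?msupp_uniq //=.
    by rewrite big_rmcond //= => m /memN_msupp_eq0 ->; rewrite scale0r.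
  by move=> m /msize_mdeg_lt /leq_trans; apply.
move=> a p q.
(* Any common bound on the three degrees will do. *)
pose d := maxn (msize (a *: p + q)) (maxn (msize p) (msize q)).
rewrite !(bound d) ?leq_max ?leqnn ?orbT //.
rewrite scaler_sumr -big_split; apply: eq_bigr => m _ /=.
by rewrite mcoeffD mcoeffZ scalerDl scalerA.
Qed.

Lemma pd_normal_order mu (f : {mpoly k[n.+1]}) :
  pd mu (normal_order f) = normal_order (f^`M(mu)).
Proof.
have nX m : normal_order 'X_[m] = word m descending.
  by rewrite normal_orderE msuppX big_seq1 mcoeffX eqxx scale1r.
have nl := normal_order_linear; have pl := @pd_linear k n mu.
rewrite {2}[f]mpolyE linear_sum normal_orderE.
rewrite (linear_at_sum pl) (linear_at_sum nl); apply: eq_bigr => m _.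
rewrite (linear_atZ pl) linearZ /= (linear_atZ nl) mderivX (linear_atZ nl) nX.
by rewrite pd_word ?descending_pairwise // mem_descending.
Qed.

End NormalOrdering.

(** * The ideal of elements without constant and linear part *)

Section KappaIdeal.
Variables (k : fieldType) (n : nat).
Notation U := (uenv (bnp k n)).
Implicit Types (mu nu : 'I_n.+1) (u v : U).
Local Notation X := (@xgen k n).

Definition kappa_ideal u : Prop :=
  counit u = 0 /\ forall mu, lin_coef mu u = 0.

Lemma kappa_ideal_subspace : subspace kappa_ideal.
Proof.
split=> [|a u v [u0 ul] [v0 vl]].
  split=> [|mu]; first exact: counit0.
  by rewrite (linear_at0 (@lin_coef_linear k n mu)).
split=> [|mu]; first by rewrite counit_linear u0 v0 mulr0 addr0.
by rewrite lin_coef_linear ul vl scaler0 addr0.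
Qed.

Lemma kappa_idealM a u : kappa_ideal u -> kappa_ideal (a * u).
Proof.
move=> [u0 ul]; split=> [|mu]; first by rewrite counitM u0 mulr0.
by rewrite lin_coefM ul u0 !mulr0 addr0.
Qed.

Lemma kappa_ideal_calculus : is_calculus kappa_ideal.
Proof.
apply: left_ideal_calculus => [|u []//|a u]; first exact: kappa_ideal_subspace.
exact: kappa_idealM.
Qed.

Definition lin_part u : bnp k n := \row_mu lin_coef mu u.

Lemma lin_part_linear : linear lin_part.
Proof. by move=> a u v; apply/rowP=> mu; rewrite !mxE lin_coef_linear. Qed.

Lemma lin_part_uin x : lin_part (uin x) = x.
Proof. by apply/rowP=> mu; rewrite mxE lin_coef_uin. Qed.

Lemma kappa_idealP u : kappa_ideal u <-> counit u = 0 /\ lin_part u = 0.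
Proof.
split=> [[u0 ul]|[u0 /rowP ul]]; split=> //.
  by apply/rowP=> mu; rewrite !mxE ul.
by move=> mu; have := ul mu; rewrite !mxE.
Qed.

Lemma kappa_ideal_lin_part u : counit u = 0 -> kappa_ideal (u - uin (lin_part u)).
Proof.
move=> u0; apply/kappa_idealP.
rewrite (linear_atB (@counit_lin _ _)) u0 counit_uin subr0.
by rewrite (linear_atB lin_part_linear) lin_part_uin subrr.
Qed.

Lemma uin_sum (x : bnp k n) : uin x = \sum_mu x 0 mu *: X mu.
Proof.
rewrite {1}[x]row_sum_delta (linear_at_sum (@uin_linear _ _)).
by apply: eq_bigr => mu _; rewrite (linear_atZ (@uin_linear _ _)).
Qed.

(** The structure of the calculus depends on N only through N containing
    [kappa_ideal], so that the two ideals of the theorem are treated at once. *)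
Section Above.
Variable N : U -> Prop.
Hypothesis sN : subspace N.
Hypothesis NM : forall a u, N u -> N (a * u).
Hypothesis kN : forall u, kappa_ideal u -> N u.

Lemma invforms_proj_lin_part u :
  invforms_proj N u = \sum_mu lin_coef mu u *: invforms_proj N (X mu).
Proof.
have pl := invforms_proj_linear N.
transitivity (invforms_proj N (uin (lin_part u))); last first.
  rewrite uin_sum (linear_at_sum pl); apply: eq_bigr => mu _.
  by rewrite (linear_atZ pl) mxE.
rewrite -[u in LHS](subrK (counit u)%:A) (linear_atD pl) (linear_atZ pl).
rewrite invforms_proj1 scaler0 addr0.
have e : counit (u - (counit u)%:A) = 0 by apply/eqP/aug_proj_subproof.
apply/(invforms_projP sN); first by rewrite e counit_uin.
apply: kN; have := kappa_ideal_lin_part e.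
rewrite (linear_atB lin_part_linear) (linear_atZ lin_part_linear).
suff -> : lin_part 1 = 0 by rewrite scaler0 subr0.
by apply/rowP=> mu; rewrite !mxE lin_coef1.
Qed.

(** In the first leg of the coproduct of u only the linear part survives the
    projection. *)
Lemma diff_pd u :
  diff N u = \sum_mu invforms_proj N (X mu) \ox pd mu u.
Proof.
rewrite diffE /pd; move: (coprod u).
apply: (@tens_ext _ _ _ _ _ (fun t => \sum_mu
  invforms_proj N (X mu) \ox contrl (lin_coef mu) t)) => [|a s t|v w].
- apply: tlift_linear; split=> [b a u1 u2|v a b d]; last by rewrite tpurer. 
  by rewrite invforms_proj_linear // tpurel.
- rewrite scaler_sumr -big_split; apply: eq_bigr => mu _ /=.
  by rewrite (contrl_linear (@lin_coef_linear _ _ _)) tpurer.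
rewrite tlift_pure; last first.
  split=> [b a u1 u2|v' a b d]; last by rewrite tpurer.
  by rewrite invforms_proj_linear // tpurel.
rewrite invforms_proj_lin_part (linear_at_sum (tpurel _)).
apply: eq_bigr => mu _; rewrite contrl_pure ?tpureZl ?tpureZr //.
exact: lin_coef_linear.
Qed.

(** The class of x_mu is an eigenvector with character chi_mu: b x_mu and
    chi_mu(b) x_mu have the same linear part. *)
Lemma form_comm_xgen a mu :
  form_comm a (diff N (X mu)) = invforms_proj N (X mu) \ox (shift mu a - a).
Proof.
have x0 : counit (X mu) = 0 by apply: counit_uin.
rewrite diff_uin // /form_comm form_ract_pure // mul1r.
rewrite (linear_atB (tpurer _)) -/(X mu); congr (_ - _).
apply: form_lact_char => // [|b]; first exact: chi_linear.
apply: kN; split=> [|nu].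
  rewrite (linear_atB (@counit_lin _ _)) (linear_atZ (@counit_lin _ _)).
  by rewrite counitM x0 mulr0 scaler0 subr0.
have ll := @lin_coef_linear k n nu.
rewrite (linear_atB ll) (linear_atZ ll) lin_coefM x0 mulr0 addr0.
rewrite lin_coef_uin bgenE; case: eqP => [->|_]; first by rewrite mulr1 [_ *: _]mulr1 subrr.
by rewrite mulr0 scaler0 subr0.
Qed.

Lemma kappa_relations_above : kappa_relations N.
Proof.
split=> [a|i j|i|f].
- by rewrite form_comm_xgen shift0 subrr (linear_at0 (tpurer _)).
- by rewrite form_comm_xgen shift_xgen // subrr (linear_at0 (tpurer _)).
- rewrite form_comm_xgen shift_uin -/(X ord0) chi_xgen eqxx /= scale1r.
  by rewrite addrC addKr diff_uin.
rewrite diff_pd; apply: eq_bigr => mu _.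
by rewrite diff_uin // form_ract_pure // mul1r pd_normal_order.
Qed.

End Above.

(** x |-> [uin x] and the linear part are inverse to each other modulo the
    ideal. *)
Lemma kappa_ideal_dim : calculus_dim kappa_ideal n.+1.
Proof.
have sK := aug_subspace kappa_ideal_subspace.
have augP (x : bnp k n) : uin x \in @aug_pred k (bnp k n).
  by apply/eqP/counit_uin.
pose f (x : 'rV[k]_n.+1) : invforms kappa_ideal :=
  qproj (fun u : aug (bnp k n) => kappa_ideal (val u)) (Aug (augP x)).
have fl : linear f.
  move=> a x y; rewrite /f -linearP; congr (qproj _ _).
  by apply: val_inj; apply: uin_linear.
pose FM := GRing.isLinear.Build k _ _ _ f fl.
pose F : {linear 'rV[k]_n.+1 -> invforms kappa_ideal} := HB.pack f FM.
exists F; exists (fun q => lin_part (val (repr q))) => [x|q] /=.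
  have := qreprP (M := fun u : aug (bnp k n) => kappa_ideal (val u)) (Aug (augP x)).
  move=> /(lspan_id sK) /kappa_idealP[_].
  rewrite [val (_ - _)]/= (linear_atB lin_part_linear) lin_part_uin.
  by move/eqP; rewrite subr_eq0 => /eqP.
rewrite -[RHS]qrepr; apply/qprojP/(lspan_id sK) => /=.
set u := repr q; have u0 : counit (val u) = 0 by apply/eqP/(valP u).
rewrite -opprB -scaleN1r; apply: (subspaceZ kappa_ideal_subspace).
exact: kappa_ideal_lin_part.
Qed.

End KappaIdeal.

(** * Inverse images under Lie algebra maps *)

Section Functoriality.
Variables (k : fieldType) (n p : nat) (f : bnp k n -> bnp k p).
Hypothesis fm : lie_morph f.
Hypothesis f0 : f (bgen k ord0) = bgen k ord0.

(** Bracketing with x_0 gives [x, x_0] = x_0-coordinate of x times x_0, minus x;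
    applying f to this identity and comparing it with the one for f x leaves the
    0-coordinates. *)
Lemma lie_morph_coord0 x : f x 0 0 = x 0 0.
Proof.
have [fl fb] := fm; have b0 q : bgen k (ord0 : 'I_q.+1) 0 0 = 1 by rewrite bgenE eqxx.
have := fb x (bgen k ord0); rewrite f0 /lie /= /bnp_lie (linear_atB fl).
rewrite !(linear_atZ fl) f0 !b0 !scale1r => /addIr /rowP/(_ 0).
by rewrite !mxE !eqxx !mulr1 => ->.
Qed.

(** The linear parts obey a rule that uses the Lie bracket with x_0 only, hence
    is preserved by every Lie map fixing x_0. *)
Lemma lin_part_uinM (q : nat) (x : bnp k q) (u : uenv (bnp k q)) :
  lin_part (uin x * u) =
  x 0 0 *: lie (bgen k ord0) (lin_part u) + counit u *: x.
Proof.
apply/rowP=> mu; rewrite /lie /= !mxE lin_coefM lin_coef_uin chi_uin eqxx.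
rewrite mul1r [counit u * _]mulrC; congr (_ + _).
case: (eqVneq mu ord0) => [->|_] /=; first by rewrite !mul0r mulr1 subrr mulr0.
by rewrite !mul1r mulr0 subr0.
Qed.

Lemma umap_lin_part u :
  counit (umap f u) = counit u /\ lin_part (umap f u) = f (lin_part u).
Proof.
have [fl fb] := fm; have fr := umap_rep fm.
move: u; apply: uenv_ind => [|a u v [u0 ul] [v0 vl]|x u [u0 ul]].
- have l1 q : lin_part (1 : uenv (bnp k q)) = 0.
    by apply/rowP=> mu; rewrite !mxE lin_coef1.
  by rewrite /umap (ulift1 fr) !counit1 !l1 (linear_at0 fl).
- rewrite /umap (ulift_linear fr) !counit_linear u0 v0; split=> //.
  by rewrite !lin_part_linear ul vl fl.
rewrite /umap (uliftM fr) (ulift_in fr) !counitM !counit_uin !mul0r; split=> //.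
rewrite !lin_part_uinM u0 ul lie_morph_coord0 (linear_atD fl).
by rewrite !(linear_atZ fl) fb f0.
Qed.

Lemma kappa_ideal_umap u :
  kappa_ideal (umap f u) <-> counit u = 0 /\ f (lin_part u) = 0.
Proof. by have [<- <-] := umap_lin_part u; apply: kappa_idealP. Qed.

End Functoriality.

Section Pullbacks.
Variables (k : fieldType) (n : nat).
Implicit Types (u : uenv (bnp k n)).

(** The maps x_0 |-> H, x_i |-> c_i X, enough to separate the points of b_N. *)
Definition scaled_proj (c : 'I_n -> k) : bnp k n -> bnp k 1 :=
  bnp_map (fun mu => if unlift ord0 mu is Some i then c i *: bgen k ord_max
                     else bgen k ord0).

Lemma bgen_max : bgen k (ord_max : 'I_2) = bgen k (lift ord0 (ord0 : 'I_1)).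
Proof. by congr (bgen k _); apply: val_inj. Qed.

Lemma scaled_proj_morph c : lie_morph (scaled_proj c).
Proof.
apply: (bnp_presentation _ _).1 => [i|i j] /=; rewrite ?unlift_none !liftK bgen_max.
  by rewrite (linear_atZ (lielr _)) bgen_lie0.
by rewrite (linear_atZ (lielr _)) (linear_atZ (liell _)) liexx !scaler0.
Qed.

Lemma scaled_proj0 c : scaled_proj c (bgen k ord0) = bgen k ord0.
Proof. by rewrite /scaled_proj bnp_map_gen unlift_none. Qed.

Lemma scaled_proj_max c x :
  scaled_proj c x 0 ord_max = \sum_(i < n) c i * x 0 (lift ord0 i).
Proof.
rewrite /scaled_proj /bnp_map big_ord_recl unlift_none mxE summxE.
rewrite !mxE /= mulr0 add0r; apply: eq_bigr => i _.
by rewrite liftK !mxE !eqxx !mulr1 mulrC.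
Qed.

Lemma bnp_proj0 : bnp_proj (bgen k (ord0 : 'I_n.+1)) = bgen k ord0.
Proof. by rewrite /bnp_proj bnp_map_gen eqxx. Qed.

(** The scaled projection with c the indicator of i detects the coordinate i,
    and every scaled projection detects the coordinate 0. *)
Lemma inducedE u : induced n (@kappa_ideal k 1) u <-> kappa_ideal u.
Proof.
split=> [uM|/kappa_idealP[u0 ul] f fm f0]; last first.
  by apply/kappa_ideal_umap => //; rewrite ul (linear_at0 fm.1).
have sP c := (kappa_ideal_umap (@scaled_proj_morph c) (@scaled_proj0 c) u).1
  (uM _ (@scaled_proj_morph c) (@scaled_proj0 c)).
apply/kappa_idealP; split; first by case: (sP (fun => 0)).
apply/rowP=> mu; rewrite [RHS]mxE; case: (unliftP ord0 mu) => [i ->|->].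
  have [_ /rowP/(_ ord_max)] := sP (fun j => (j == i)%:R).
  rewrite scaled_proj_max mxE (bigD1 i) //= eqxx mul1r big1 ?addr0 //.
  by move=> j /negbTE->; rewrite mul0r.
have [_ p0] := sP (fun => 0); have pm := @scaled_proj_morph (fun => 0).
by rewrite -(lie_morph_coord0 pm (@scaled_proj0 _)) p0 mxE.
Qed.

Lemma pullbackE u : pullback n (@kappa_ideal k 1) u <->
  counit u = 0 /\ bnp_proj (lin_part u) = 0.
Proof. exact: (kappa_ideal_umap (bnp_proj_morph k n) bnp_proj0). Qed.

Lemma bnp_perm0 (s : 'S_n) : bnp_perm s (bgen k ord0) = bgen k ord0.
Proof. by rewrite /bnp_perm bnp_map_gen unlift_none. Qed.

Lemma bnp_proj_perm (s : 'S_n) (x : bnp k n) : bnp_proj (bnp_perm s x) = bnp_proj x.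
Proof.
have pl := (bnp_proj_morph k n).1.
rewrite {1}/bnp_perm /bnp_map (linear_at_sum pl); apply: eq_bigr => mu _.
rewrite (linear_atZ pl); congr (_ *: _).
by case: (unliftP ord0 mu) => [i ->|->]; rewrite /bnp_proj bnp_map_gen.
Qed.

Lemma kappa_ideal_sub_pullback u : kappa_ideal u -> pullback n (@kappa_ideal k 1) u.
Proof.
move=> /kappa_idealP[u0 ul]; apply/pullbackE.
by rewrite ul (linear_at0 (bnp_proj_morph k n).1).
Qed.

Lemma pullback_subspace : subspace (pullback n (@kappa_ideal k 1)).
Proof.
have fr := umap_rep (bnp_proj_morph k n).
have [M0 Ml] := @kappa_ideal_subspace k 1.
rewrite /pullback /umap; split=> [|a u v uM vM]; first by rewrite (ulift0 fr).
by rewrite (ulift_linear fr); apply: Ml.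
Qed.

Lemma pullbackM a u : pullback n (@kappa_ideal k 1) u ->
  pullback n (@kappa_ideal k 1) (a * u).
Proof.
rewrite /pullback /umap (uliftM (umap_rep (bnp_proj_morph k n))).
exact: kappa_idealM.
Qed.

Lemma pullback_calculus : is_calculus (pullback n (@kappa_ideal k 1)).
Proof.
apply: left_ideal_calculus => [|u /pullbackE[]//|a u].
  exact: pullback_subspace.
exact: pullbackM.
Qed.

Lemma kappa_ideal_perm : perm_invariant (@kappa_ideal k n).
Proof.
move=> s u /kappa_idealP[u0 ul].
apply/(kappa_ideal_umap (bnp_perm_morph k s) (bnp_perm0 s)).
by rewrite ul (linear_at0 (bnp_perm_morph k s).1).
Qed.

Lemma pullback_perm : perm_invariant (pullback n (@kappa_ideal k 1)).
Proof.
move=> s u /pullbackE[u0 ul]; apply/pullbackE.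
have [-> ->] := umap_lin_part (bnp_perm_morph k s) (bnp_perm0 s) u.
by rewrite bnp_proj_perm.
Qed.

(** With at most two generators the projection b_N -> b_+ is injective. *)
Lemma pullback_small u : (n.+1 <= 2)%N ->
  pullback n (@kappa_ideal k 1) u -> kappa_ideal u.
Proof.
move=> n1 /pullbackE[u0 ul]; apply/kappa_idealP; split=> //.
have x0 := lie_morph_coord0 (bnp_proj_morph k n) bnp_proj0 (lin_part u).
move: ul x0; set x := lin_part u => ul; rewrite ul mxE => x0.
apply/rowP=> mu; rewrite [RHS]mxE; case: (unliftP ord0 mu) => [i|] ->; last by rewrite -x0.
have /rowP/(_ ord_max) := ul; rewrite /bnp_proj /bnp_map big_ord_recl mxE summxE.
rewrite !mxE /= mulr0 add0r (bigD1 i) //= big1 => [|j].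
  by rewrite !mxE mulr1 addr0.
have /eqP-> : i == j.
  move: (leq_trans (ltn_ord i) n1) (leq_trans (ltn_ord j) n1).
  rewrite !ltnS !leqn0 => /eqP i0 /eqP j0.
  by apply/eqP/val_inj; rewrite /= i0 j0.
by rewrite eqxx.
Qed.

End Pullbacks.

(** * Existence and uniqueness of the natural calculus on U(b_+) *)

Section Natural.
Variable k : fieldType.
Local Notation U := (uenv (bnp k 1)).
Local Notation X := (Xgen k).
Local Notation H := (Hgen k).

Lemma pd_horner n (mu nu : 'I_n.+1) (P : {poly k}) :
  pd mu (horner_alg (xgen k nu) P) =
  if mu == nu then horner_alg (xgen k nu) P^`() else 0.
Proof.
have pl := @pd_linear k n mu.
rewrite -[P]coefK poly_def !linear_sum (linear_at_sum pl) /=.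
transitivity (\sum_(i < size P)
  if mu == nu then horner_alg (xgen k nu) (P`_i *: 'X^i)^`() else 0).
  apply: eq_bigr => i _; rewrite derivZ !linearZ /= !mulr_algl (linear_atZ pl).
  rewrite derivXn rmorphMn !rmorphXn /= horner_algX pd_exp.
  by case: ifP => _; rewrite ?scaler0 // scaler_nat.
by case: ifP => _ //; rewrite big1.
Qed.

Lemma natural_kappa_ideal : natural_calculus (@kappa_ideal k 1).
Proof.
have sM := @kappa_ideal_subspace k 1.
have dP (mu : 'I_2) (P : {poly k}) :
    diff (@kappa_ideal k 1) (horner_alg (xgen k mu) P) =
    form_ract (diff (@kappa_ideal k 1) (xgen k mu)) (horner_alg (xgen k mu) P^`()).
  rewrite (diff_pd sM) // (bigD1 mu) //= big1 ?addr0 => [|nu /negbTE nu_mu].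
    by rewrite pd_horner eqxx diff_uin form_ract_pure mul1r.
  by rewrite pd_horner nu_mu (linear_at0 (tpurer _)).
have d0 (mu : 'I_2) : diff (@kappa_ideal k 1) (xgen k mu) <> 0.
  move=> /(congr1 (@forms_counit _ _ _)).
  rewrite forms_counit_diff (linear_at0 (@forms_counit_linear _ _ _)).
  move=> /(invforms_proj_eq0 sM (counit_uin _))[_ /(_ mu)/eqP].
  by rewrite lin_coef_uin bgenE eqxx oner_eq0.
split; [exact: kappa_ideal_calculus | exact: kappa_ideal_dim | exact: d0..|].
by move=> P; split; apply: dP.
Qed.

(** Write e and f as the rows of a square matrix: it is invertible or its rows
    are dependent. *)
Lemma dim2_span (V : lmodType k) (e f : V) : has_dim V 2 ->
  (exists x y : k, (x, y) != (0, 0) /\ x *: e + y *: f = 0) \/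
  (forall v, exists x y : k, v = x *: e + y *: f).
Proof.
move=> [F [G GF FG]].
pose A : 'M[k]_(1 + 1) := col_mx (G e) (G f).
have FA (w : 'rV[k]_(1 + 1)) :
    F (w *m A) = w 0 (lshift 1 0) *: e + w 0 (rshift 1 0) *: f.
  rewrite -[in LHS](hsubmxK w) mul_row_col (mx11_scalar (lsubmx w)).
  rewrite (mx11_scalar (rsubmx w)) !mul_scalar_mx.
  rewrite linearD !linearZ /= !FG; by congr (_ *: _ + _ *: _); rewrite !mxE.
case: (boolP (A \in unitmx)) => [uA|]; [right=> v | move=> uA; left].
  exists ((G v *m invmx A) 0 (lshift 1 0)), ((G v *m invmx A) 0 (rshift 1 0)).
  by rewrite -FA mulmxKV.
move: uA; rewrite unitmxE unitfE negbK => /det0P[w w0 wA].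
exists (w 0 (lshift 1 0)), (w 0 (rshift 1 0)); split; last first.
  by rewrite -FA wA linear0.
apply: contraNneq w0 => -[w1 w2]; rewrite -[w]hsubmxK.
by rewrite (mx11_scalar (lsubmx w)) (mx11_scalar (rsubmx w)) !mxE w1 w2 !raddf0 row_mx0.
Qed.

Section Uniqueness.
Variable M : U -> Prop.
Hypothesis Mnat : natural_calculus M.

Let Mcalc : is_calculus M. Proof. by case: Mnat. Qed.
Let sM : subspace M. Proof. by case: Mcalc. Qed.
Let MM a u : M u -> M (a * u). Proof. by case: Mcalc => _ _ h _; apply: h. Qed.
Let MD := subspaceD sM.
Let MB := subspaceB sM.
Let MZ := subspaceZ sM.

Let X0 : counit X = 0. Proof. exact: counit_uin. Qed.
Let H0 : counit H = 0. Proof. exact: counit_uin. Qed.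

Lemma comm_HX : H * X = X * H + X.
Proof. by rewrite /Hgen /Xgen /xgen uin_comm !bgen_max bgen_lie0. Qed.

Lemma natural_notin : ~ M X /\ ~ M H.
Proof.
have ex x : diff M (uin x) <> 0 -> ~ M (uin x).
  move=> d0 /(invforms_proj_eq0 sM (counit_uin x)) e; apply: d0.
  by rewrite diff_uin e (linear_at0 (tpurel _)).
by case: Mnat => _ _ /ex ? /ex ? _.
Qed.

(** For u = x in g, d(x^2) = dx (2x); the counit kills the right factor, so the
    class of x^2 vanishes. *)
Lemma natural_sqr : M (X * X) /\ M (H * H).
Proof.
have sq x : diff M (horner_alg (uin x) 'X^2) =
    form_ract (diff M (uin x)) (horner_alg (uin x) ('X^2)^`()) ->
    M (uin x * uin x).
  move=> /(congr1 (@forms_counit _ _ _)).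
  rewrite forms_counit_ract !forms_counit_diff derivXn rmorphMn !rmorphXn /=.
  rewrite horner_algX expr1 (linear_atD (@counit_lin _ _)) counit_uin addr0.
  rewrite scale0r expr2 => /(invforms_proj_eq0 sM); apply.
  by rewrite counitM counit_uin mul0r.
by case: Mnat => _ _ _ _ dP; split; apply: sq; case: (dP 'X^2).
Qed.

(** Multiplying a relation x X + y H = 0 modulo M by X gives y XH = 0, and by H
    gives x HX = 0. If x and y are both nonzero then X = HX - XH is 0, which is
    excluded; if one of them is zero then X or H is 0. *)
Lemma natural_indep (x y : k) : M (x *: X + y *: H) -> x = 0 /\ y = 0.
Proof.
have [MXX MHH] := natural_sqr; have [nX nH] := natural_notin => Mxy.
have inv c u : c != 0 -> M (c *: u) -> M u.
  by move=> c0 /(MZ c^-1); rewrite scalerA mulVf // scale1r.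
have y0 : y = 0.
  apply/eqP/negP => /negP y0; apply: nX.
  have MXH : M (X * H).
    apply: (inv y) => //; have := MB (MM X Mxy) (MZ x MXX).
    by rewrite mulrDr -!scalerAr addrAC subrr add0r.
  case: (eqVneq x 0) => [x0|x0].
    by move: Mxy; rewrite x0 scale0r add0r => /(inv _ _ y0)/nH.
  have MHX : M (H * X).
    apply: (inv x) => //; have := MB (MM H Mxy) (MZ y MHH).
    by rewrite mulrDr -!scalerAr addrK.
  by have := MB MHX MXH; rewrite comm_HX addrAC subrr add0r.
split=> //; apply/eqP/negP => /negP x0; apply/nX/(inv x) => //.
by move: Mxy; rewrite y0 scale0r addr0.
Qed.

(** Modulo M let XH = x X + y H. Multiplying by H on the left, with
    HXH = X H^2 + XH, gives (1 - x) XH = x X, hence - x^2 X + (1 - x) y H = 0.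
    Independence of X and H forces x = 0 and then y = 0. *)
Lemma natural_XH : M (X * H).
Proof.
have [MXX MHH] := natural_sqr; have pl := @invforms_proj_linear _ _ M.
have projE x y u : counit u = 0 ->
    invforms_proj M u = x *: invforms_proj M X + y *: invforms_proj M H <->
    M (u - (x *: X + y *: H)).
  move=> u0; rewrite -!(linear_atZ pl) -(linear_atD pl).
  apply: invforms_projP => //; rewrite u0.
  by rewrite counit_linear (linear_atZ (@counit_lin _ _)) X0 H0 mulr0 scaler0 addr0.
have dimM : calculus_dim M 2 by case: Mnat.
have XH0 : counit (X * H) = 0 by rewrite counitM H0 mulr0.
case: (dim2_span (invforms_proj M X) (invforms_proj M H) dimM).
  case=> x [y [/eqP xy0 exy]]; case: xy0.
  have := (projE x y 0 (counit0 _)).1; rewrite exy (linear_at0 pl) sub0r => /(_ erefl).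
  by move=> /(MZ (-1)); rewrite scaleN1r opprK => /natural_indep[-> ->].
move=> /(_ (invforms_proj M (X * H)))[x [y /(projE _ _ _ XH0) e]].
have MXHH : M (X * H * H) by rewrite -mulrA; apply: MM.
(* H * e, corrected by X H^2 and y H^2. *)
have e2 : M ((1 - x) *: (X * H) - x *: X).
  have := MD (MB (MM H e) MXHH) (MZ y MHH).
  rewrite mulrBr mulrDr -!scalerAr mulrA comm_HX mulrDl.
  rewrite [X * H * H + _]addrC [_ + X * H * H - _]addrAC addrK opprD addrA subrK.
  by rewrite scalerDr opprD addrA scalerBl scale1r.
(* Substitute XH = x X + y H in e2. *)
have : M (- x ^+ 2 *: X + ((1 - x) * y) *: H).
  have := MB e2 (MZ (1 - x) e); rewrite scalerBr opprB addrC addrA subrK.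
  rewrite scalerDr !scalerA addrAC -scalerBl; congr M; congr (_ *: _ + _); ring.
move=> /natural_indep[/eqP]; rewrite oppr_eq0 expf_eq0 /= => /eqP x0.
rewrite x0 subr0 mul1r => y0.
by move: e; rewrite x0 y0 !scale0r addr0 subr0.
Qed.

Lemma uin2 (x : bnp k 1) : uin x = x 0 0 *: H + x 0 ord_max *: X.
Proof.
rewrite uin_sum !big_ord_recl big_ord0 addr0.
by have -> : lift ord0 ord0 = ord_max :> 'I_2 by apply: val_inj.
Qed.

Lemma natural_uinM (x d : bnp k 1) :
  M (uin x * uin d - x 0 0 *: uin (lie (bgen k ord0) d)).
Proof.
have [MXX MHH] := natural_sqr.
rewrite {1}uin2 mulrDl -!scalerAl /Hgen /xgen uin_comm scalerDr addrAC addrK.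
rewrite (uin2 d) mulrDl mulrDr -!scalerAl -!scalerAr.
by apply: MD; apply: MZ; apply: MD; apply: MZ => //; apply: natural_XH.
Qed.

(** The right-hand terms depend on u as in [lin_part_uinM], and [natural_uinM]
    says that modulo M the product of two elements of g obeys the same rule. *)
Lemma natural_decomp u : M (u - (counit u)%:A - uin (lin_part u)).
Proof.
move: u; apply: uenv_ind => [|a u v IHu IHv|x u IHu].
- have -> : lin_part (1 : U) = 0 by apply/rowP=> mu; rewrite !mxE lin_coef1.
  rewrite counit1 scale1r subrr (linear_at0 (@uin_linear _ _)) subr0.
  exact: subspace0.
- have := MD (MZ a IHu) IHv; congr M.
  rewrite lin_part_linear counit_linear uin_linear !scalerBr scalerDl scalerA.
  by rewrite addrACA [X in X + _ = _]addrACA -!opprD.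
rewrite counitM counit_uin mul0r scale0r subr0 lin_part_uinM.
rewrite (linear_atD (@uin_linear _ _)) !(linear_atZ (@uin_linear _ _)).
have := MD (MM (uin x) IHu) (natural_uinM x (lin_part u)); congr M.
by rewrite !mulrBr -scalerAr mulr1 addrA subrK opprD addrA addrAC.
Qed.

Lemma natural_unique u : M u <-> kappa_ideal u.
Proof.
split=> [Mu|/kappa_idealP[u0 ul]]; last first.
  by have := natural_decomp u; rewrite u0 ul scale0r (linear_at0 (@uin_linear _ _)) !subr0.
have u0 : counit u = 0 by case: Mcalc => _ h _ _; apply: h.
apply/kappa_idealP; split=> //; have := MB Mu (natural_decomp u).
rewrite u0 scale0r subr0 opprB addrC subrK uin_sum !big_ord_recl big_ord0 addr0 addrC.
have -> : lift ord0 ord0 = ord_max :> 'I_2 by apply: val_inj.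
move=> /natural_indep[l1 l0]; apply/rowP=> mu; rewrite [RHS]mxE.
case: (unliftP ord0 mu) => [i|] -> //; rewrite -l1; congr (lin_part u _ _).
by apply: val_inj; case: i => [[]].
Qed.

End Uniqueness.
End Natural.

(* The Lie algebra b_{N+} with N = n.+1 generators is [bnp k n], and b_+ is
   [bnp k 1]. *)
Theorem corollary5p1 (k : fieldType) (char0 : [pchar k] =i pred0) (n : nat) :
  exists M : uenv (bnp k 1) -> Prop,
    [/\ natural_calculus M,
        forall M' : uenv (bnp k 1) -> Prop,
          natural_calculus M' -> forall u, M' u <-> M u,
        [/\ is_calculus (induced n M), perm_invariant (induced n M),
            calculus_dim (induced n M) n.+1
          & kappa_relations (induced n M)]
      & [/\ is_calculus (pullback n M), perm_invariant (pullback n M),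
            kappa_relations (pullback n M),
            forall u, induced n M u -> pullback n M u
          & (n.+1 <= 2)%N -> forall u, pullback n M u -> induced n M u]].
Proof.
have sK := @kappa_ideal_subspace k n; have sP := @pullback_subspace k n.
have indE : induced n (@kappa_ideal k 1) = @kappa_ideal k n.
  by apply/funext => u; apply/propext; apply: inducedE.
exists (@kappa_ideal k 1); rewrite indE.
split; first exact: natural_kappa_ideal.
- by move=> M' M'nat u; apply: natural_unique.
- split; [exact: kappa_ideal_calculus | exact: kappa_ideal_perm
    | exact: kappa_ideal_dim |].
  by apply: (kappa_relations_above sK) => // a u; apply: kappa_idealM.
split; [exact: pullback_calculus | exact: pullback_perm | |
  exact: kappa_ideal_sub_pullback | by move=> n1 u; apply: pullback_small].
apply: (kappa_relations_above sP) => [a u|u]; first exact: pullbackM.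
exact: kappa_ideal_sub_pullback.
Qed.
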